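(* For sufficiently large $q$, it holds that $$q^{2-o(1)}<C(3,q,\{1,1,1\})=o(q^2)$$ and $$q^{2-o(1)}<C(4,q,\{1,1,1,1\})\le C(4,q,\{1,1,2\})\le C(4,q,\{2,2\})=o(q^2),$$ where the $o(\cdot)$ terms are as $q\to\infty$.
   Context: An $SHF(N;n,q,\{w_1,\ldots,w_t\})$ (separating hash family of type $\{w_1,\ldots,w_t\}$, a multiset of positive integers) is an $N\times n$ matrix over an alphabet of $q$ symbols such that for any pairwise disjoint sets $C_1,\ldots,C_t$ of columns with $|C_i|=w_i$ for $1\le i\le t$ there is a row in which the sets of entries of $C_1,\ldots,C_t$ are pairwise disjoint. $C(N,q,\{w_1,\ldots,w_t\})$ denotes the maximal $n$ such that there exists an $SHF(N;n,q,\{w_1,\ldots,w_t\})$. The lower bound $q^{2-o(1)}<C$ means that there is a function $\eta(q)\to 0$ as $q\to\infty$ with $q^{2-\eta(q)}<C$ for all sufficiently large $q$. *)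

(* Defs.v *)
From HB Require Import structures.
From mathcomp Require Import all_boot all_order all_algebra.
From mathcomp Require Import boolp classical_sets reals.
From mathcomp Require Import topology normedtype landau exp.

Set Implicit Arguments.
Unset Strict Implicit.
Unset Printing Implicit Defensive.

(* The multiset {w_1, ..., w_t} is represented by a list w of its elements;
   the order of the list is immaterial. *)
Definition is_SHF (N n q : nat) (w : seq nat) (A : 'M['I_q]_(N, n)) : Prop :=
  forall C : 'I_(size w) -> {set 'I_n},
    (forall i j, i != j -> [disjoint C i & C j]) ->
    (forall i, #|C i| = nth 0 w i) ->
    exists r : 'I_N,
      forall i j, i != j -> [disjoint A r @: C i & A r @: C j].

Definition SHF_exists (N n q : nat) (w : seq nat) : Prop :=
  exists A : 'M['I_q]_(N, n), is_SHF w A.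

Definition is_max_SHF (N q : nat) (w : seq nat) (n : nat) : Prop :=
  SHF_exists N n q w /\ forall m, SHF_exists N m q w -> m <= n.

(* The default value 0 is never reached when w consists of at least two
   positive integers; see max_SHFP. *)
Definition max_SHF (N q : nat) (w : seq nat) : nat :=
  xget 0 (is_max_SHF N q w).

Section MaxSHF.
Variables (N q : nat).
Implicit Type w : seq nat.

Lemma SHF_exists0 w : 0 < size w -> all (leq 1) w -> SHF_exists N 0 q w.
Proof.
case: w => [//|a w] _ /= /andP[a0 _].
have f : 'I_0 -> 'I_q by case.
exists (\matrix_(i < N, j < 0) f j)%R.
move=> C _ /(_ ord0) /= Ca; suff : #|C ord0| <= 0 by rewrite Ca leqNgt a0.
by rewrite (leq_trans (max_card _)) ?card_ord.
Qed.

Lemma SHF_exists_le n w : 1 < size w -> all (leq 1) w ->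
  SHF_exists N n q w -> n <= q ^ N + sumn w.
Proof.
move=> w1 w0 [A shfA]; rewrite leqNgt; apply/negP => n_large.
pose f (j : 'I_n) : {ffun 'I_N -> 'I_q} := [ffun r => A r j].
have /injectivePn[x [y xy fxy]] : ~~ injectiveb f.
  apply/negP => /injectiveP /leq_card; rewrite card_ffun !card_ord.
  by rewrite leqNgt (leq_ltn_trans (leq_addr _ _) n_large).
pose a := nth 0 w 0.
have a0 : 0 < a by apply: (all_nthP 0 w0); apply: ltnW.
have wn : sumn w <= n by rewrite ltnW // (leq_ltn_trans (leq_addl _ _) n_large).
pose rest := enum (~: [set x; y]).
pose s := (x :: take a.-1 rest) ++ y :: drop a.-1 rest.
have s_perm : perm_eq s [:: x, y & rest].
  rewrite /s cat_cons perm_cons -[in X in perm_eq _ X](cat_take_drop a.-1 rest).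
  by rewrite -cat1s -[y :: _ ++ _]cat1s perm_catCA.
have us : uniq s.
  rewrite (perm_uniq s_perm) /= inE negb_or xy !mem_enum !finset.in_setC !finset.in_set2.
  by rewrite !eqxx orbT enum_uniq.
have srest : (size rest).+2 = n.
  rewrite /rest -cardE; have := cardsC [set x; y].
  by rewrite cards2 xy card_ord.
have ss : size s = n by rewrite (perm_size s_perm).
have aw : a < sumn w.
  move: w1 w0; rewrite /a; case: (w) => [|b [|c v]] //= _ /and3P[_ c0 _].
  by rewrite -[ltnLHS]addn0 ltn_add2l addn_gt0 c0.
have arest : a.-1 <= size rest.
  by rewrite -2!ltnS srest prednK //; apply: leq_trans aw wn.
pose C (i : 'I_(size w)) : {set 'I_n} :=
  [set nth x s (flatten_index w i (nat_of_ord c)) | c : 'I_(nth 0 w i)].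
have idx (i : 'I_(size w)) (c : 'I_(nth 0 w i)) :
    flatten_index w i c < size s.
  by rewrite ss (leq_trans _ wn) // flatten_indexP.
have Cdisj i j : i != j -> [disjoint C i & C j].
  move=> ij; apply/pred0P => z /=; apply/negP => /andP[].
  move=> /imsetP[c _ ->] /imsetP[d _] /eqP.
  rewrite nth_uniq // => /eqP /(congr1 (reshape_index w)).
  by rewrite !flatten_indexKl // => /val_inj /eqP; apply/negP.
have Ccard i : #|C i| = nth 0 w i.
  rewrite card_imset ?card_ord // => c d /eqP.
  rewrite nth_uniq // => /eqP /(congr1 (reshape_offset w)).
  by rewrite !flatten_indexKr // => /val_inj.
have [r rP] := shfA C Cdisj Ccard.
have w00 : 0 < size w by apply: ltnW.
pose i0 := Ordinal w00; pose i1 := Ordinal w1.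
have c00 : 0 < nth 0 w i0 by [].
have c01 : 0 < nth 0 w i1 by apply: (all_nthP 0 w0).
have xC : x \in C i0.
  by apply/imsetP; exists (Ordinal c00) => //; rewrite /flatten_index take0.
have yC : y \in C i1.
  apply/imsetP; exists (Ordinal c01) => //=.
  have -> : flatten_index w 1 0 = a.
    by rewrite /flatten_index /a; case: (w) => //= b v; rewrite take0 /= !addn0.
  by rewrite /s nth_cat /= size_takel // prednK // ltnn subnn.
have := rP i0 i1 isT; move/pred0P/(_ (A r x)) => /=.
rewrite imset_f //=; move/ffunP/(_ r): fxy; rewrite !ffunE => ->.
by rewrite imset_f.
Qed.

Lemma max_SHFP w : 1 < size w -> all (leq 1) w ->
  is_max_SHF N q w (max_SHF N q w).
Proof.
move=> w1 w0; apply: xgetPex.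
have ex0 : exists n, `[< SHF_exists N n q w >].
  by exists 0; apply/asboolP/SHF_exists0 => //; apply: ltnW.
have bnd n : `[< SHF_exists N n q w >] -> n <= q ^ N + sumn w.
  by move=> /asboolP; apply: SHF_exists_le.
case: (ex_maxnP ex0 bnd) => n /asboolP nP nmax.
by exists n; split=> // m mP; apply/nmax/asboolP.
Qed.

End MaxSHF.

(* Main.v *)
(** Upper bounds.  Discard the O(q) columns having a symbol that few columns
    share.  Any two remaining columns agree in at most one row, since otherwise
    the frequent symbols in the other rows supply a forbidden configuration.
    For type {1,1,1} the three rows then form a system of edge-disjoint
    triangles without any further triangle; for type {2,2} the absence of
    4-cycles meeting the rows in the order 0,1,2,3 forces every column to lie in
    boundedly many further triangles either on the rows 0,1,2 or on the rows
    0,3,2.  Both times triangle removal yields o(q^2) columns.  Triangle removal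
    follows from an energy increment argument over labelings of the vertices,
    whose classes are not required to have equal sizes.

    Lower bounds.  Columns are pairs (x, s) of vectors over Z[l] with small
    digits, where l^3 = 2 l^2 + l - 1, and row i contains x + a_i s for
    (a_0, ..., a_3) = (0, 1, l, 3).  A Gram matrix of s, hence its norm in every
    real embedding, is kept constant as in Behrend's construction.  Columns that
    are separated in no row contain a cycle of length 3 or 4 whose consecutive
    columns agree in distinct rows.  Such a cycle is degenerate as soon as the
    slopes increase around it in some real embedding, because then one vector s
    is a convex combination of the others and all lie on one sphere.  A single
    real embedding would only treat one of the three cyclic orders of four
    slopes; the three roots of the cubic, one in each of (-1, 0), (0, 1) and
    (2, 3), treat all of them. *)

From mathcomp Require Import all_boot all_order all_algebra.
From mathcomp Require Import ring lra zify.
Require Import Defs.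
Set Implicit Arguments.
Unset Strict Implicit.
Unset Printing Implicit Defensive.
Import Order.TTheory GRing.Theory Num.Theory.
Local Open Scope ring_scope.

(** * Regularity for families of relations *)

Section Averaging.
Variables (R : realFieldType) (U : finType) (f : U -> R).

(** The conditional expectation of [f] given the partition into fibers of [k]. Partitions are
    labelings, so their cells may have any sizes. *)
Definition avg (K : eqType) (k : U -> K) (u : U) : R :=
  (\sum_(v | k v == k u) f v) / #|[pred v | k v == k u]|%:R.

Definition energy (K : eqType) (k : U -> K) : R := \sum_u avg k u ^+ 2.

Lemma fiber_gt0 (K : eqType) (k : U -> K) u :
  0 < #|[pred v | k v == k u]|%:R :> R.
Proof. by rewrite ltr0n; apply/card_gt0P; exists u; rewrite inE. Qed.

Lemma avg_adjoint (K : eqType) (k : U -> K) (phi : U -> R) :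
  (forall u v, k u = k v -> phi u = phi v) ->
  \sum_u avg k u * phi u = \sum_u f u * phi u.
Proof.
move=> phik.
transitivity (\sum_u \sum_(v | k v == k u)
    f v * phi v / #|[pred w | k w == k v]|%:R).
  apply: eq_bigr => u _; rewrite /avg -mulrA mulr_suml; apply: eq_bigr => v /eqP kvu.
  by rewrite kvu (phik v u) // mulrA mulrAC.
rewrite (exchange_big_dep xpredT) //=; apply: eq_bigr => v _.
rewrite sumr_const (eq_card (B := [pred w | k w == k v])); last first.
  by move=> w; rewrite !inE eq_sym.
by rewrite -[LHS]mulr_natr divfK // gt_eqF // fiber_gt0.
Qed.

Lemma avg_fiber (K : eqType) (k : U -> K) u v : k u = k v -> avg k u = avg k v.
Proof. by rewrite /avg => ->. Qed.

(** Pythagoras: [k] factors through [k'], so [avg k] is the projection of [avg k'] and the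
    difference is orthogonal to it. *)
Lemma energy_refine (K K' : eqType) (k : U -> K) (k' : U -> K') (h : K' -> K) :
  (forall u, k u = h (k' u)) ->
  energy k' = energy k + \sum_u (avg k' u - avg k u) ^+ 2.
Proof.
move=> kh.
have a1 : \sum_u avg k' u * avg k u = energy k.
  rewrite avg_adjoint; last by move=> u v e; apply: avg_fiber; rewrite !kh e.
  rewrite -(@avg_adjoint _ k); last exact: avg_fiber.
  by apply: eq_bigr.
have -> : \sum_u (avg k' u - avg k u) ^+ 2 =
    energy k' - 2 * (\sum_u avg k' u * avg k u) + energy k.
  rewrite mulr_sumr -sumrB -big_split /=.
  by apply: eq_bigr => u _; ring.
by rewrite a1; ring.
Qed.

Lemma energy_le (K : eqType) (k : U -> K) :
  (forall u, 0 <= f u <= 1) -> energy k <= #|U|%:R.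
Proof.
move=> f01; rewrite -sum1_card natr_sum; apply: ler_sum => u _.
have c0 := fiber_gt0 k u.
have a0 : 0 <= avg k u.
  by apply: divr_ge0 (ltW c0); apply: sumr_ge0 => v _; case/andP: (f01 v).
have a1 : avg k u <= 1.
  rewrite ler_pdivrMr // mul1r -sum1_card natr_sum; apply: ler_sum => v _.
  by case/andP: (f01 v).
by rewrite expr_le1.
Qed.

Lemma energy_ge0 (K : eqType) (k : U -> K) : 0 <= energy k.
Proof. by apply: sumr_ge0 => u _; rewrite sqr_ge0. Qed.

End Averaging.

(** * Lower-regular pairs of cells and the energy increment *)

Definition triangles (V : finType) (E1 E2 E3 : rel V) :=
  [set t : V * V * V | [&& E1 t.1.1 t.1.2, E2 t.1.2 t.2 & E3 t.1.1 t.2]].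

Section Regularity.
Variables (R : realFieldType) (V I : finType) (E : I -> rel V) (alpha : R).
Hypotheses (alpha0 : 0 < alpha) (alpha1 : alpha <= 1).

Definition edges i (A B : {set V}) : R :=
  \sum_(x in A) \sum_(y in B) (E i x y)%:R.

(** One-sided: only too low a density is a defect, because counting triangles takes lower bounds on
    densities. *)
Definition sparse_spot i (A B : {set V}) (p : {set V} * {set V}) :=
  [&& p.1 \subset A, p.2 \subset B, alpha * #|A|%:R <= #|p.1|%:R,
      alpha * #|B|%:R <= #|p.2|%:R &
      edges i p.1 p.2 < alpha * (#|p.1|%:R * #|p.2|%:R)].

Definition lower_regular i A B := [forall p, ~~ sparse_spot i A B p].

(* Pairs of density below [2 * alpha] count as regular; their edges are removed
   separately. *)
Definition irregular i (A B : {set V}) :=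
  (2 * alpha * (#|A|%:R * #|B|%:R) <= edges i A B) && ~~ lower_regular i A B.

(** Without a sparse spot the default [(A, B)] cuts nothing off. *)
Definition spot i A B := odflt (A, B) [pick p | sparse_spot i A B p].

Lemma spotP i A B : irregular i A B -> sparse_spot i A B (spot i A B).
Proof.
case/andP=> _ /forallPn[p]; rewrite negbK /spot => pP.
by case: pickP => [//|/(_ p)]; rewrite pP.
Qed.

Let U : finType := (I * (V * V))%type.
Definition edge_val (u : U) : R := (E u.1 u.2.1 u.2.2)%:R.
Local Notation f := edge_val.

Definition pair_label (T : Type) (c : V -> T) (u : U) := (u.1, (c u.2.1, c u.2.2)).

Definition cell (T : eqType) (c : V -> T) (s : T) := [set x | c x == s].

(** All pairs of cells are cut at their spots simultaneously: the bits tell on which side of each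
    cut [x] lies, as a left and as a right vertex. *)
Definition split_label (T : finType) (c : V -> T) (x : V) :
    (T * {ffun I * T -> bool} * {ffun I * T -> bool})%type :=
  (c x, [ffun it => x \in (spot it.1 (cell c (c x)) (cell c it.2)).1],
   [ffun it => x \in (spot it.1 (cell c it.2) (cell c (c x))).2]).

Lemma sum_box (F : U -> R) i (A B : {set V}) :
  \sum_(u : U | [&& u.1 == i, u.2.1 \in A & u.2.2 \in B]) F u =
  \sum_(x in A) \sum_(y in B) F (i, (x, y)).
Proof.
rewrite (eq_bigl (fun u : U => (u.1 == i) && ((u.2.1 \in A) && (u.2.2 \in B)))) //.
transitivity (\sum_(j | j == i) \sum_(p : V * V | (p.1 \in A) && (p.2 \in B)) F (j, p)).
  by rewrite pair_big_dep /=; apply: eq_bigr => -[j p].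
rewrite big_pred1_eq pair_big_dep /=.
by apply: eq_bigr => -[x y].
Qed.

Lemma fiber_box (T : eqType) (c : V -> T) i s t (u : U) :
  (pair_label c u == (i, (s, t))) =
  [&& u.1 == i, u.2.1 \in cell c s & u.2.2 \in cell c t].
Proof. by rewrite !inE /pair_label -!pair_eqE. Qed.

Lemma card_fiber (T : eqType) (c : V -> T) i s t :
  #|[pred u : U | pair_label c u == (i, (s, t))]|%:R =
  #|cell c s|%:R * #|cell c t|%:R :> R.
Proof.
transitivity (\sum_(u : U | [&& u.1 == i, u.2.1 \in cell c s & u.2.2 \in cell c t]) 1 : R).
  by rewrite -[in LHS]sum1_card natr_sum; apply: eq_bigl => u; apply: fiber_box.
rewrite sum_box.
under eq_bigr do rewrite sumr_const.
by rewrite sumr_const mulr_natl.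
Qed.

(** On the box [W] spanned by the spot, the old average is at least [2 * alpha]; the new one has
    mean below [alpha], as [W] is a union of new fibers. This gains [alpha ^+ 2] per point of [W],
    and [W] fills at least a share [alpha ^+ 2] of the pair of cells. *)
Lemma increment_fiber (T : finType) (c : V -> T) i s t :
  irregular i (cell c s) (cell c t) ->
  alpha ^+ 4 * (#|cell c s|%:R * #|cell c t|%:R) <=
  \sum_(u | pair_label c u == (i, (s, t)))
     (avg f (pair_label (split_label c)) u - avg f (pair_label c) u) ^+ 2.
Proof.
set A := cell c s; set B := cell c t => irr.
have /andP[dense _] := irr.
have := spotP irr; set p := spot i A B => /and5P[pA pB sA sB sparse].
set c' := split_label c; set k := pair_label c; set k' := pair_label c'.
pose W := [pred u : U | [&& u.1 == i, u.2.1 \in p.1 & u.2.2 \in p.2]].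
have Wk u : W u -> k u = (i, (s, t)).
  case: u => j [x y] /and3P[/= /eqP -> xp yp]; rewrite /k /pair_label /=.
  have := subsetP pA x xp; have := subsetP pB y yp.
  by rewrite !inE => /eqP -> /eqP ->.
have Wk' u v : k' u = k' v -> W u -> W v.
  case: u v => [j [x y]] [j' [x' y']] [ej ex ux uy' ey uy vy].
  move=> /and3P[/= /eqP ji xp yp].
  have := Wk (j, (x, y)); rewrite /= ji eqxx xp yp => /(_ isT) [cx cy].
  rewrite -ej -ji eqxx /= ; apply/andP; split.
    move/ffunP/(_ (i, t)): ux; rewrite !ffunE /=.
    by rewrite -ex cx -/A -/B -/p => <-.
  move/ffunP/(_ (i, s)): vy; rewrite !ffunE /=.
  by rewrite -ey cy -/A -/B -/p => <-.
have avgk u : W u -> 2 * alpha <= avg f k u.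
  move=> /Wk ku; rewrite /avg ku -/k (card_fiber c) -/A -/B.
  have AB0 : 0 < #|A|%:R * #|B|%:R :> R.
    by rewrite -(card_fiber c i) -/k -ku fiber_gt0.
  rewrite ler_pdivlMr // (eq_bigl _ _ (fiber_box c i s t)) sum_box.
  exact: dense.
have WE (F : U -> R) : \sum_(u | W u) F u = \sum_u F u * (W u)%:R.
  rewrite [LHS]big_mkcond; apply: eq_bigr => u _.
  by case: ifP; rewrite ?mulr1 ?mulr0.
have sumW : \sum_(u | W u) avg f k' u = edges i p.1 p.2.
  rewrite WE avg_adjoint; last first.
    by move=> u v kuv; congr (nat_of_bool _)%:R; apply/idP/idP; apply: Wk'.
  by rewrite -WE sum_box.
have cardW : \sum_(u | W u) 1 = #|p.1|%:R * #|p.2|%:R :> R.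
  rewrite sum_box; under eq_bigr do rewrite sumr_const.
  by rewrite sumr_const mulr_natl.
have step : alpha ^+ 2 * (#|p.1|%:R * #|p.2|%:R) <=
    \sum_(u | W u) (avg f k' u - avg f k u) ^+ 2.
  (* [h^2 >= 2 alpha h - alpha^2] replaces Cauchy-Schwarz. *)
  apply: (@le_trans _ _ (\sum_(u | W u) (3 * alpha ^+ 2 * 1 - 2 * alpha * avg f k' u))).
    rewrite sumrB -!mulr_sumr sumW cardW.
    have := ler_wpM2l (ltW alpha0) (ltW sparse).
    set m := #|p.1|%:R * _; set e := edges _ _ _; lra.
  apply: ler_sum => u /avgk; set a := avg f k u; set a' := avg f k' u => ha.
  have := sqr_ge0 (a - a' - alpha); have := ler_wpM2l (ltW alpha0) ha; nra.
apply: (@le_trans _ _ (alpha ^+ 2 * (#|p.1|%:R * #|p.2|%:R))).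
  rewrite (_ : alpha ^+ 4 * _ = alpha ^+ 2 * ((alpha * #|A|%:R) * (alpha * #|B|%:R))); last by ring.
  by rewrite ler_wpM2l ?sqr_ge0 // ler_pM // mulr_ge0 // ltW.
apply: (le_trans step); rewrite [leRHS](bigID W) [X in _ <= X + _](eq_bigl W).
  by rewrite lerDl sumr_ge0 // => u _; rewrite sqr_ge0.
by move=> u; apply/andP/idP => [[]//|Wu]; split=> //; apply/eqP/Wk.
Qed.

Definition irregular_at (T : eqType) (c : V -> T) (k : I * (T * T)) :=
  irregular k.1 (cell c k.2.1) (cell c k.2.2).

Lemma card_label (T : finType) (c : V -> T) (P : pred (I * (T * T))) :
  #|[pred u | P (pair_label c u)]|%:R =
  \sum_(k | P k) #|cell c k.2.1|%:R * #|cell c k.2.2|%:R :> R.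
Proof.
rewrite -[in LHS]sum1_card natr_sum (partition_big (pair_label c) P) //=.
apply: eq_bigr => -[i [s t]] Pk; rewrite -(card_fiber c i) -[in RHS]sum1_card natr_sum.
apply: eq_bigl => u; rewrite !unfold_in /= andb_idl // => /eqP ->; exact: Pk.
Qed.

Lemma energy_increment (T : finType) (c : V -> T) :
  energy f (pair_label c) +
    alpha ^+ 4 * #|[pred u | irregular_at c (pair_label c u)]|%:R <=
  energy f (pair_label (split_label c)).
Proof.
rewrite (@energy_refine _ _ f _ _ (pair_label c) (pair_label (split_label c))
  (fun k => (k.1, (k.2.1.1.1, k.2.2.1.1)))) //.
rewrite lerD2l card_label mulr_sumr [leRHS](partition_big (pair_label c) xpredT) //=.
rewrite big_mkcond; apply: ler_sum => -[i [s t]] _.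
case: ifP => [|_]; first exact: increment_fiber.
by apply: sumr_ge0 => u _; rewrite sqr_ge0.
Qed.

Definition regular_label (T : finType) (c : V -> T) :=
  #|[pred u | irregular_at c (pair_label c u)]|%:R <= alpha * #|U|%:R.

Lemma edges_card i A B :
  edges i A B = \sum_(x in A) #|[set y in B | E i x y]|%:R.
Proof.
apply: eq_bigr => x _; rewrite -sum1_card natr_sum [RHS]big_mkcond [LHS]big_mkcond.
by apply: eq_bigr => y _; rewrite inE; case: (y \in B); case: (E i x y).
Qed.

Lemma lower_regularP i (A B A' B' : {set V}) : lower_regular i A B ->
  A' \subset A -> B' \subset B ->
  alpha * #|A|%:R <= #|A'|%:R -> alpha * #|B|%:R <= #|B'|%:R ->
  alpha * (#|A'|%:R * #|B'|%:R) <= edges i A' B'.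
Proof.
move=> /forallP/(_ (A', B')) + sA sB cA cB.
by rewrite /sparse_spot /= sA sB cA cB /= -leNgt.
Qed.

(** A larger set of such vertices, paired with all of [B], would itself be a sparse spot. *)
Lemma few_low_degree i (A B : {set V}) : lower_regular i A B ->
  #|[set x in A | #|[set y in B | E i x y]|%:R < alpha * #|B|%:R]|%:R <=
  alpha * #|A|%:R.
Proof.
set L := [set x in A | _] => reg; rewrite leNgt; apply/negP => largeL.
have LA : L \subset A by apply/subsetP => x; rewrite inE => /andP[].
have := lower_regularP reg LA (subxx B) (ltW largeL) _.
rewrite ler_piMl ?ler0n // => /(_ isT); apply/negP; rewrite -ltNge.
have L0 : 0 < #|L|%:R :> R by apply: le_lt_trans largeL; rewrite mulr_ge0 // ltW.
rewrite edges_card.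
have [x xL] : exists x, x \in L by apply/card_gt0P; rewrite -(ltr0n R).
rewrite (_ : alpha * _ = \sum_(x in L) alpha * #|B|%:R); last first.
  by rewrite sumr_const -[RHS]mulr_natl mulrCA.
apply: ltr_sum => [|y]; last by rewrite inE => /andP[].
by apply/hasP; exists x; rewrite ?mem_index_enum.
Qed.

(** By [4 * alpha <= 1], at least half of [A] has large neighborhoods in both [B] and [C]. Lower
    regularity of [B] and [C] gives many edges between these neighborhoods, each closing a
    triangle. *)
Lemma triangle_count i1 i2 i3 (A B C : {set V}) : 4 * alpha <= 1 ->
  lower_regular i1 A B -> lower_regular i2 B C -> lower_regular i3 A C ->
  alpha ^+ 3 / 2 * (#|A|%:R * #|B|%:R * #|C|%:R) <=
  #|triangles (E i1) (E i2) (E i3)|%:R.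
Proof.
move=> a4 rAB rBC rAC.
pose NB x := [set y in B | E i1 x y]; pose NC x := [set y in C | E i3 x y].
pose LB := [set x in A | #|NB x|%:R < alpha * #|B|%:R].
pose LC := [set x in A | #|NC x|%:R < alpha * #|C|%:R].
pose G := A :\: (LB :|: LC).
have cardG : #|A|%:R / 2 <= #|G|%:R :> R.
  have : #|A|%:R <= #|G|%:R + #|LB|%:R + #|LC|%:R :> R.
    rewrite -!natrD ler_nat -addnA.
    apply: leq_trans (leq_add (leqnn _) (leq_card_setU LB LC)).
    rewrite -(cardsID (LB :|: LC) A) addnC leq_add2l.
    by rewrite subset_leq_card ?subsetIr.
  have := few_low_degree rAB; have := few_low_degree rAC.
  rewrite -/(NC _) -/(NB _) -/LB -/LC.
  have : 0 <= #|A|%:R :> R by []. 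
  nra.
apply: (@le_trans _ _ (\sum_(x in G) alpha ^+ 3 * (#|B|%:R * #|C|%:R))).
  rewrite sumr_const -[leRHS]mulr_natl.
  rewrite (_ : _ * _ = #|A|%:R / 2 * (alpha ^+ 3 * (#|B|%:R * #|C|%:R))); last by field.
  rewrite ler_wpM2r //; apply: mulr_ge0; last exact: mulr_ge0.
  by rewrite exprn_ge0 // ltW.
apply: (@le_trans _ _ (\sum_(x in G) edges i2 (NB x) (NC x))).
  apply: ler_sum => x; rewrite !inE negb_or !negb_and => /andP[/andP[xB xC] xA].
  rewrite xA /= -!leNgt in xB xC.
  have := lower_regularP rBC _ _ xB xC.
  have sub (D : {set V}) (P : pred V) : [set y in D | P y] \subset D.
    by apply/subsetP => y; rewrite inE => /andP[].
  rewrite !sub => /(_ isT isT); apply: le_trans.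
  rewrite (_ : alpha ^+ 3 * _ = alpha * ((alpha * #|B|%:R) * (alpha * #|C|%:R))); last by ring.
  apply: (ler_wpM2l (ltW alpha0)).
  by rewrite ler_pM // mulr_ge0 // ltW.
have -> : \sum_(x in G) edges i2 (NB x) (NC x) =
    \sum_(t : V * V * V | [&& t.1.1 \in G, t.1.2 \in NB t.1.1, t.2 \in NC t.1.1 & E i2 t.1.2 t.2]) 1.
  transitivity (\sum_(x in G) \sum_(y in NB x) \sum_(z in NC x | E i2 y z) (1 : R)).
    apply: eq_bigr => x _; apply: eq_bigr => y _.
    by rewrite [RHS]big_mkcondr; apply: eq_bigr => z _; case: (E i2 y z).
  by rewrite pair_big_dep pair_big_dep /=; apply: eq_bigl => -[[x y] z] /=; rewrite !andbA.
rewrite -sum1_card natr_sum [leRHS]big_mkcond [leLHS]big_mkcond.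
apply: ler_sum => -[[x y] z] _ /=; rewrite !inE /=.
case: (E i1 x y); case: (E i2 y z); case: (E i3 x z); rewrite ?andbF ?andbT //=.
by case: ifP.
Qed.

End Regularity.

(** Induction on the number [m] of rounds left: splitting a labeling that is not regular gains at
    least [alpha ^+ 5] of the maximal energy, and for [m = 0] no gain is possible. *)
Lemma regularization (R : realFieldType) (I : finType) (alpha : R) (m K0 : nat) :
  0 < alpha -> alpha <= 1 ->
  exists K, forall (V : finType) (E : I -> rel V) (T : finType) (c : V -> T),
    (#|T| <= K0)%N ->
    (1 - m%:R * alpha ^+ 5) * #|{: I * (V * V)}|%:R <=
      energy (edge_val R E) (pair_label c) ->
    exists (T' : finType) (c' : V -> T'),
      (#|T'| <= K)%N /\ regular_label E alpha c'.
Proof.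
move=> alpha0 alpha1; elim: m K0 => [|m IHm] K0.
  exists K0 => V E T c TK; rewrite mul0r subr0 mul1r => en.
  exists T, c; split=> //; rewrite /regular_label leNgt; apply/negP => irr.
  have := energy_increment E alpha0 c.
  have edge01 u : 0 <= edge_val R E u <= 1.
    by rewrite /edge_val; case: (E _ _ _); rewrite ?lexx ?ler01.
  have le := energy_le (pair_label (split_label E alpha c)) edge01.
  have : 0 < alpha ^+ 4 * #|[pred u | irregular_at E alpha c (pair_label c u)]|%:R.
    by rewrite mulr_gt0 ?exprn_gt0 //; apply: le_lt_trans irr; rewrite mulr_ge0 // ltW.
  move: le; lra.
(* A split adds two families of [#|I| * K0] bits to each label. *)
have [K KP] := IHm (K0 * 2 ^ (#|I| * K0) * 2 ^ (#|I| * K0))%N.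
exists (maxn K0 K) => V E T c TK en.
have [reg|irr] := boolP (regular_label E alpha c).
  by exists T, c; rewrite leq_max TK.
have [|| T' [c' [T'K reg]]] := KP V E _ (split_label E alpha c).
- rewrite !card_prod !card_ffun !card_prod card_bool.
  by rewrite !leq_mul // leq_exp2l // leq_mul.
- apply: le_trans (energy_increment E alpha0 c).
  move: irr; rewrite /regular_label -ltNge => /ltW irr.
  have := ler_wpM2l (exprn_ge0 4 (ltW alpha0)) irr.
  rewrite mulrA -exprSr; move: en; rewrite -natr1; lra.
by exists T', c'; rewrite leq_max T'K orbT.
Qed.

(** * Triangle removal *)

Section Cleaning.
Variables (R : realFieldType) (V I : finType) (E : I -> rel V) (alpha : R).
Variables (T : finType) (c : V -> T) (K : nat).
Hypotheses (alpha0 : 0 < alpha) (TK : (#|T| <= K)%N) (K0 : (0 < K)%N).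

Lemma sum_cell : \sum_s #|cell c s|%:R = #|V|%:R :> R.
Proof.
rewrite -[in RHS]sum1_card natr_sum (partition_big c xpredT) //=.
apply: eq_bigr => s _; rewrite -sum1_card natr_sum.
by apply: eq_bigl => x; rewrite inE.
Qed.

Definition small_cell (s : T) : bool := #|cell c s|%:R < alpha * #|V|%:R / K%:R.

Lemma small_points : #|[pred x | small_cell (c x)]|%:R <= alpha * #|V|%:R.
Proof.
rewrite -sum1_card natr_sum (partition_big c small_cell) //=.
have K0' : 0 < K%:R :> R by rewrite ltr0n.
apply: (@le_trans _ _ (\sum_(s : T) alpha * #|V|%:R / K%:R)).
  rewrite big_mkcond; apply: ler_sum => s _; case: ifP => [sm|_]; last first.
    by rewrite divr_ge0 ?ler0n // mulr_ge0 // ltW.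
  apply: le_trans (ltW sm); rewrite -sum1_card natr_sum [leRHS]big_mkcond [leLHS]big_mkcond.
  by apply: ler_sum => x _; rewrite !inE; case: (c x == s); rewrite ?andbF ?andbT //; case: ifP.
rewrite sumr_const -[leLHS]mulr_natl mulrA ler_pdivrMr // mulrC ler_wpM2l ?ler_nat //.
by rewrite mulr_ge0 // ltW.
Qed.

Definition sparse_cells i (s t : T) : bool :=
  edges R E i (cell c s) (cell c t) < 2 * alpha * (#|cell c s|%:R * #|cell c t|%:R).

Lemma sparse_pairs i :
  #|[pred p | E i p.1 p.2 && sparse_cells i (c p.1) (c p.2)]|%:R <=
  2 * alpha * #|V|%:R ^+ 2.
Proof.
rewrite -sum1_card natr_sum.
rewrite (partition_big (fun p => (c p.1, c p.2)) (fun st => sparse_cells i st.1 st.2));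
  last by move=> p /andP[].
apply: (@le_trans _ _ (\sum_(st : T * T)
    2 * alpha * (#|cell c st.1|%:R * #|cell c st.2|%:R))).
  rewrite big_mkcond; apply: ler_sum => -[s t] _ /=; case: ifP => [sp|_]; last first.
    by rewrite !mulr_ge0 // ltW.
  apply: le_trans (ltW sp); rewrite /edges pair_big_dep /= [leRHS]big_mkcond [leLHS]big_mkcond.
  apply: ler_sum => -[x y] _ /=; rewrite !inE /= xpair_eqE.
  by case: (E i x y); case: (c x == s); case: (c y == t); rewrite ?andbF ?andbT //=; case: (sparse_cells _ _ _).
rewrite -mulr_sumr; apply: ler_wpM2l; first by rewrite mulr_ge0 // ltW.
rewrite -(pair_bigA _ (fun s t => #|cell c s|%:R * #|cell c t|%:R)) /=.
by under eq_bigr do rewrite -mulr_sumr sum_cell; rewrite -mulr_suml sum_cell.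
Qed.

Definition fine_cells i (s t : T) :=
  [&& lower_regular E alpha i (cell c s) (cell c t), ~~ small_cell s & ~~ small_cell t].

Definition bad_pairs i :=
  [set p : V * V | E i p.1 p.2 && ~~ fine_cells i (c p.1) (c p.2)].

(** Irregular pairs account for [#|I|], as [regular_label] bounds all relations jointly; sparse
    pairs account for 2, and small cells at either end for 1 each. *)
Lemma card_bad_pairs i : regular_label E alpha c ->
  #|bad_pairs i|%:R <= (#|I|%:R + 4) * alpha * #|V|%:R ^+ 2.
Proof.
move=> reg.
pose X1 := [set p : V * V | irregular_at E alpha c (i, (c p.1, c p.2))].
pose X2 := [set p : V * V | E i p.1 p.2 && sparse_cells i (c p.1) (c p.2)].
pose S := [set x | small_cell (c x)].
have cX1 : #|X1|%:R <= #|I|%:R * alpha * #|V|%:R ^+ 2.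
  move: reg; rewrite /regular_label !card_prod !natrM => /le_trans-/(_ (#|I|%:R * alpha * #|V|%:R ^+ 2)).
  have -> : alpha * (#|I|%:R * (#|V|%:R * #|V|%:R)) = #|I|%:R * alpha * #|V|%:R ^+ 2 by ring.
  move=> /(_ (lexx _)); apply: le_trans; rewrite ler_nat.
  rewrite -(card_imset (f := fun p => (i, p))); last by move=> p q [].
  by apply/subset_leq_card/subsetP => _ /imsetP[p + ->]; rewrite !inE.
have cX2 : #|X2|%:R <= 2 * alpha * #|V|%:R ^+ 2 by rewrite cardsE; exact: sparse_pairs.
have cS : #|S|%:R <= alpha * #|V|%:R by rewrite cardsE; exact: small_points.
have sub : bad_pairs i \subset X1 :|: X2 :|: setX S setT :|: setX setT S.
  apply/subsetP => -[x y]; rewrite !inE /= => /andP[Exy].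
  rewrite Exy /fine_cells /irregular_at /irregular /sparse_cells ltNge /= !negb_and !negbK.
  by case: (lower_regular _ _ _ _ _); case: (small_cell (c x)); case: (small_cell (c y)); case: (_ <= _).
have : #|bad_pairs i|%:R <= #|X1|%:R + #|X2|%:R + #|S|%:R * #|V|%:R + #|V|%:R * #|S|%:R :> R.
  rewrite -!natrM -!natrD ler_nat (leq_trans (subset_leq_card sub)) //.
  have -> : (#|S| * #|V| = #|setX S [set: V]|)%N by rewrite cardsX cardsT.
  have -> : (#|V| * #|S| = #|setX [set: V] S|)%N by rewrite cardsX cardsT.
  apply: leq_trans (leq_card_setU _ _) _; rewrite leq_add2r.
  apply: leq_trans (leq_card_setU _ _) _; rewrite leq_add2r.
  exact: leq_card_setU.
have := ler_wpM2r (ler0n R #|V|) cS; nra.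
Qed.

End Cleaning.

(** The injectivity hypotheses make the triangles of [J] edge-disjoint, so each bad edge spoils at
    most one of them. One therefore survives with all edges in fine cells, and [triangle_count]
    applies to its three cells. *)
Theorem triangle_removal (R : archiRealFieldType) (eps : R) : 0 < eps ->
  exists2 delta : R, 0 < delta &
  forall (V D : finType) (E1 E2 E3 : rel V) (J : {set D}) (r1 r2 r3 : D -> V),
    (0 < #|V|)%N ->
    {in J, forall j, [/\ E1 (r1 j) (r2 j), E2 (r2 j) (r3 j) & E3 (r1 j) (r3 j)]} ->
    {in J &, injective (fun j => (r1 j, r2 j))} ->
    {in J &, injective (fun j => (r2 j, r3 j))} ->
    {in J &, injective (fun j => (r1 j, r3 j))} ->
    eps * #|V|%:R ^+ 2 <= #|J|%:R ->
    delta * #|V|%:R ^+ 3 <= #|triangles E1 E2 E3|%:R.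
Proof.
(* Each of the three relations spoils at most [7 * alpha * #|V|%:R ^+ 2] triangles, so
   [22 * alpha <= eps] leaves a survivor. *)
move=> eps0; pose alpha := eps / (22 + 4 * eps).
have den0 : 0 < 22 + 4 * eps by lra.
have alpha0 : 0 < alpha by rewrite divr_gt0.
have alpha4 : 4 * alpha <= 1 by rewrite mulrA ler_pdivrMr //; lra.
have alphaeps : 22 * alpha <= eps by rewrite mulrA ler_pdivrMr //; nra.
have alpha1 : alpha <= 1 by lra.
(* Enough rounds for the one-cell labeling to satisfy the energy hypothesis of [regularization]. *)
pose m := Num.bound (alpha ^+ 5)^-1.
have m5 : 1 <= m%:R * alpha ^+ 5.
  rewrite -ler_pdivrMr ?exprn_gt0 // div1r ltW // archi_boundP //.
  by rewrite invr_ge0 exprn_ge0 // ltW.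
have [K KP] := @regularization _ (option bool) _ m 1 alpha0 alpha1.
pose K' := K.+1.
have K'0 : 0 < K'%:R :> R by [].
exists (alpha ^+ 3 / 2 * (alpha / K'%:R) ^+ 3).
  by rewrite mulr_gt0 ?divr_gt0 ?exprn_gt0 // divr_gt0.
move=> V D E1 E2 E3 J r1 r2 r3 V0 JE inj1 inj2 inj3 large.
pose E (i : option bool) := if i is Some b then if b then E1 else E2 else E3.
have [||T [c [/leqW TK reg]]] := KP V E unit (fun=> tt); first by rewrite card_unit.
  apply: le_trans (energy_ge0 _ _); rewrite mulr_le0_ge0 //; lra.
have VR0 : 0 < #|V|%:R :> R by rewrite ltr0n.
pose fine := fine_cells E alpha c K'.
pose F i (p : D -> V * V) := [set j in J | ~~ fine i (c (p j).1) (c (p j).2)].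
have cF i p : {in J &, injective p} -> {in J, forall j, E i (p j).1 (p j).2} ->
    #|F i p|%:R <= 7 * alpha * #|V|%:R ^+ 2.
  move=> injp pE; apply: (@le_trans _ _ #|bad_pairs E alpha c K' i|%:R).
    rewrite ler_nat -(card_in_imset (f := p)); last first.
      by move=> j k; rewrite !inE => /andP[jJ _] /andP[kJ _]; apply: injp.
    apply/subset_leq_card/subsetP => _ /imsetP[j + ->].
    by rewrite !inE => /andP[jJ ->]; rewrite pE.
  apply: le_trans (card_bad_pairs _ _ _ _ reg) _ => //.
  by rewrite card_option card_bool -natrD.
have [j jJ [f1 f2 f3]] : exists2 j, j \in J & [/\ fine (Some true) (c (r1 j)) (c (r2 j)),
    fine (Some false) (c (r2 j)) (c (r3 j)) & fine None (c (r1 j)) (c (r3 j))].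
  have [/exists_inP[j jJ /and3P[]]|] := boolP [exists j in J,
    [&& fine (Some true) (c (r1 j)) (c (r2 j)), fine (Some false) (c (r2 j)) (c (r3 j))
      & fine None (c (r1 j)) (c (r3 j))]]; first by exists j.
  move=> /exists_inPn none.
  have sub : J \subset F (Some true) (fun j => (r1 j, r2 j)) :|:
      F (Some false) (fun j => (r2 j, r3 j)) :|: F None (fun j => (r1 j, r3 j)).
    by apply/subsetP => j jJ; have := none j jJ; rewrite !inE jJ /= !negb_and orbA.
  have {sub} : #|J|%:R <= #|F (Some true) (fun j => (r1 j, r2 j))|%:R +
      #|F (Some false) (fun j => (r2 j, r3 j))|%:R + #|F None (fun j => (r1 j, r3 j))|%:R :> R.
    rewrite -!natrD ler_nat (leq_trans (subset_leq_card sub)) //.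
    by apply: leq_trans (leq_card_setU _ _) _; rewrite leq_add2r leq_card_setU.
  have := cF (Some true) _ inj1; have := cF (Some false) _ inj2; have := cF None _ inj3.
  move=> /(_ _)/wrap[k /JE[]//|l3] /(_ _)/wrap[k /JE[]//|l2] /(_ _)/wrap[k /JE[]//|l1] l.
  have : 0 < #|V|%:R ^+ 2 :> R by rewrite exprn_gt0.
  by set q := _ ^+ 2 in large l1 l2 l3 *; nra.
move: f1 f2 f3 => /and3P[reg1 A0 B0] /and3P[reg2 _ C0] /and3P[reg3 _ _].
rewrite /small_cell -!leNgt in A0 B0 C0.
apply: le_trans (triangle_count alpha0 alpha1 alpha4 reg1 reg2 reg3).
rewrite -mulrA; apply: ler_wpM2l; first by rewrite divr_ge0 // exprn_ge0 // ltW.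
rewrite -exprMn mulrAC exprS exprS expr1 mulrA.
have a0 : 0 <= alpha * #|V|%:R / K'%:R by rewrite divr_ge0 // mulr_ge0 // ltW.
by rewrite !ler_pM // mulr_ge0.
Qed.

(** * Upper bounds *)

(** The middle vertices of the triangles on the edge [(r1 j, r3 j)], in the tripartite graph whose
    edges come from columns in [J]. *)
Definition joins (D S : finType) (J : {set D}) (r1 r2 r3 : D -> S) (j : D) :=
  [set y | [exists k in J, (r1 k == r1 j) && (r2 k == y)] &&
           [exists k in J, (r2 k == y) && (r3 k == r3 j)]].

Lemma joins_mono (D S : finType) (J J' : {set D}) (r1 r2 r3 : D -> S) j :
  J' \subset J -> joins J' r1 r2 r3 j \subset joins J r1 r2 r3 j.
Proof.
move=> sJ; apply/subsetP => y; rewrite !inE => /andP[/exists_inP[k kJ e] /exists_inP[l lJ f]].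
by apply/andP; split; apply/exists_inP; [exists k | exists l] => //; apply: (subsetP sJ).
Qed.

(** Every triangle lies on the edge [(r1 j, r3 j)] of some [j], and [J] has at most [q ^ 2]
    elements. So there are at most [m * q ^ 2] triangles, fewer than the cubic number that a large
    [J] would force. *)
Lemma linear_triples_small (R : archiRealFieldType) (eps : R) (m : nat) : 0 < eps ->
  exists q0 : nat, forall q (D : finType) (J : {set D}) (r1 r2 r3 : D -> 'I_q),
    (q0 <= q)%N ->
    {in J &, injective (fun j => (r1 j, r2 j))} ->
    {in J &, injective (fun j => (r2 j, r3 j))} ->
    {in J &, injective (fun j => (r1 j, r3 j))} ->
    {in J, forall j, (#|joins J r1 r2 r3 j| <= m)%N} ->
    #|J|%:R < eps * q%:R ^+ 2.
Proof.
move=> eps0; have [delta delta0 removal] := triangle_removal eps0.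
exists (Num.bound (m%:R / delta)).+1 => q D J r1 r2 r3 q0q inj1 inj2 inj3 joinm.
rewrite ltNge; apply/negP => large.
pose E (r r' : D -> 'I_q) x y := [exists k in J, (r k == x) && (r' k == y)].
have EJ r r' j : j \in J -> E r r' (r j) (r' j).
  by move=> jJ; apply/exists_inP; exists j; rewrite ?eqxx.
have := removal 'I_q D (E r1 r2) (E r2 r3) (E r1 r3) J r1 r2 r3.
rewrite card_ord => /(_ (leq_trans (ltn0Sn _) q0q)).
move=> /(_ _ inj1 inj2 inj3 large)/wrap[j jJ|many]; first by split; apply: EJ.
pose P := [set p : D * 'I_q | (p.1 \in J) && (p.2 \in joins J r1 r2 r3 p.1)].
have few : (#|triangles (E r1 r2) (E r2 r3) (E r1 r3)| <= m * q ^ 2)%N.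
  apply: (@leq_trans #|P|).
    apply: leq_trans (leq_imset_card (fun p => (r1 p.1, p.2, r3 p.1)) P).
    apply/subset_leq_card/subsetP => -[[x y] z].
    rewrite inE /= => /and3P[xy yz /exists_inP[j jJ /andP[/eqP jx /eqP jz]]].
    apply/imsetP; exists (j, y); last by rewrite /= jx jz.
    by rewrite !inE jJ /= jx jz; apply/andP.
  have -> : #|P| = (\sum_(j in J) #|joins J r1 r2 r3 j|)%N.
    rewrite -sum1_card; under [RHS]eq_bigr do rewrite -sum1_card.
    by rewrite pair_big_dep; apply: eq_bigl => p; rewrite inE.
  apply: (@leq_trans (\sum_(j in J) m)%N); first exact: leq_sum.
  rewrite sum_nat_const mulnC leq_mul2l; apply/orP; right.
  rewrite -(card_in_imset inj1) (leq_trans (max_card _)) //.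
  by rewrite card_prod !card_ord.
have q0 : 0 < q%:R :> R by rewrite ltr0n (leq_trans _ q0q).
have : delta * q%:R ^+ 3 <= m%:R * q%:R ^+ 2.
  by apply: le_trans many _; rewrite -natrX -natrM ler_nat.
rewrite exprS mulrA ler_pM2r ?exprn_gt0 // mulrC -ler_pdivlMr // leNgt.
apply/negP; rewrite negbK.
apply: lt_le_trans (_ : (Num.bound (m%:R / delta))%:R <= _).
  by rewrite archi_boundP // divr_ge0 // ltW.
by rewrite ler_nat ltnW.
Qed.

(** * Singleton types and comparison of types *)

Lemma is_SHF_onesP (N n q : nat) (w : seq nat) (A : 'M['I_q]_(N, n)) :
  all (pred1 1%N) w ->
  is_SHF w A <->
  forall f : 'I_(size w) -> 'I_n, injective f ->
    exists r, injective (fun i => A r (f i)).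
Proof.
move=> w1; have nw (i : 'I_(size w)) : nth 0%N w i = 1%N.
  by apply/eqP/(all_nthP 0%N w1).
split=> [shf f finj|sep C disj card].
  have [|i|r rP] := shf (fun i => [set f i]).
  - by move=> i j ij; rewrite disjoints1 inE; apply: contra_neq ij => /finj.
  - by rewrite cards1 nw.
  exists r => i j eij; apply: contraTeq isT => /rP.
  by rewrite !imset_set1 disjoints1 inE eij eqxx.
have /fin_all_exists[f fP] (i : 'I_(size w)) : exists x, C i = [set x].
  by apply/cards1P; rewrite card nw.
have [i j eij|r rinj] := sep f.
  apply: contraTeq isT => /disj; rewrite !fP eij disjoints1 inE eqxx //.
exists r => i j ij; rewrite !fP !imset_set1 disjoints1 inE.
by apply: contra_neq ij => /rinj.
Qed.

Lemma is_SHF_pairs (N n q : nat) (A : 'M['I_q]_(N, n)) (x y z t : 'I_n) :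
  is_SHF [:: 2; 2]%N A -> uniq [:: x; y; z; t] ->
  exists r, [/\ A r x != A r z, A r x != A r t, A r y != A r z & A r y != A r t].
Proof.
rewrite /= !inE !negb_or => shf /and4P[/and3P[xy xz xt] /andP[yz yt] zt _].
have d : [disjoint [set x; y] & [set z; t]].
  by rewrite disjoints_subset subUset !sub1set !inE !negb_or xz xt yz yt.
pose C (i : 'I_2) := if i == ord0 then [set x; y] else [set z; t].
have [||r /(_ ord0 ord_max isT)] := shf C.
- case=> [[|[|//]] ?] [[|[|//]] ?]; rewrite -val_eqE //= => _; rewrite /C //=.
  by rewrite disjoint_sym.
- by case=> [[|[|//]] ?]; rewrite /C /= cards2 ?xy ?zt.
rewrite /C /= !imsetU1 !imset_set1 disjoints_subset subUset !sub1set !inE !negb_or.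
by move=> /andP[/andP[? ?] /andP[? ?]]; exists r.
Qed.

Lemma is_SHF_112_of_1111 (N n q : nat) (A : 'M['I_q]_(N, n)) :
  is_SHF [:: 1; 1; 1; 1]%N A -> is_SHF [:: 1; 1; 2]%N A.
Proof.
move=> /is_SHF_onesP-/(_ isT) sep C disj card.
pose i0 : 'I_3 := @Ordinal 3 0 isT; pose i1 : 'I_3 := @Ordinal 3 1 isT.
pose i2 : 'I_3 := @Ordinal 3 2 isT.
have /eqP/cards1P[a Ca] := card i0; have /eqP/cards1P[b Cb] := card i1.
have /eqP/cards2P[c [d [cd Ccd]]] := card i2.
have := disj i0 i1 isT; have := disj i0 i2 isT; have := disj i1 i2 isT.
rewrite Ca Cb Ccd !disjoints1 !inE !negb_or => /andP[bc bd] /andP[ac ad] ab.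
have [|r rinj] := sep (fun i => nth a [:: a; b; c; d] i).
  move=> i j /eqP; rewrite nth_uniq ?ltn_ord //= => [/eqP/val_inj//|].
  by rewrite !inE !negb_or ab ac ad bc bd cd.
have neq (i j : 'I_4) : i != j -> A r (nth a [:: a; b; c; d] i) != A r (nth a [:: a; b; c; d] j).
  by apply: contra_neq => /rinj.
have ab' := neq (@Ordinal 4 0 isT) (@Ordinal 4 1 isT) isT.
have ac' := neq (@Ordinal 4 0 isT) (@Ordinal 4 2 isT) isT.
have ad' := neq (@Ordinal 4 0 isT) (@Ordinal 4 3 isT) isT.
have bc' := neq (@Ordinal 4 1 isT) (@Ordinal 4 2 isT) isT.
have bd' := neq (@Ordinal 4 1 isT) (@Ordinal 4 3 isT) isT.
rewrite /= in ab' ac' ad' bc' bd'.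
have h01 : [disjoint A r @: C i0 & A r @: C i1].
  by rewrite Ca Cb !imset_set1 disjoints1 inE.
have h02 : [disjoint A r @: C i0 & A r @: C i2].
  by rewrite Ca Ccd imsetU1 !imset_set1 disjoints1 !inE negb_or ac' ad'.
have h12 : [disjoint A r @: C i1 & A r @: C i2].
  by rewrite Cb Ccd imsetU1 !imset_set1 disjoints1 !inE negb_or bc' bd'.
exists r => i j.
have is_i (k : 'I_3) : [\/ k = i0, k = i1 | k = i2].
  by case: k => [[|[|[|//]]] ?]; [constructor 1|constructor 2|constructor 3]; apply: val_inj.
by case: (is_i i) => ->; case: (is_i j) => -> //; rewrite disjoint_sym.
Qed.

Lemma is_SHF_22_of_112 (N n q : nat) (A : 'M['I_q]_(N, n)) :
  is_SHF [:: 1; 1; 2]%N A -> is_SHF [:: 2; 2]%N A.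
Proof.
move=> shf C disj card.
pose i0 : 'I_2 := @Ordinal 2 0 isT; pose i1 : 'I_2 := @Ordinal 2 1 isT.
have /eqP/cards2P[a [b [ab Cab]]] := card i0.
have := disj i0 i1 isT; rewrite Cab disjoints_subset subUset !sub1set !inE => /andP[aC bC].
pose C' (i : 'I_3) := nth (C i1) [:: [set a]; [set b]] i.
have [||r rP] := shf C'.
- case=> [[|[|[|//]]] ?] [[|[|[|//]]] ?]; rewrite -val_eqE //= => _; rewrite /C' /=;
  by rewrite ?disjoints1 ?[[disjoint C i1 & _]]disjoint_sym ?disjoints1 ?inE // eq_sym.
- by case=> [[|[|[|//]]] ?]; rewrite /C' /= ?cards1 ?card.
have h01 : [disjoint A r @: C i0 & A r @: C i1].
  rewrite Cab imsetU1 imset_set1 disjoints_subset subUset !sub1set !inE.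
  have := rP (@Ordinal 3 0 isT) (@Ordinal 3 2 isT) isT.
  have := rP (@Ordinal 3 1 isT) (@Ordinal 3 2 isT) isT.
  by rewrite /C' /= !imset_set1 !disjoints1 => -> ->.
exists r => i j.
have is_i (k : 'I_2) : k = i0 \/ k = i1.
  by case: k => [[|[|//]] ?]; [left|right]; apply: val_inj.
by case: (is_i i) => ->; case: (is_i j) => -> //; rewrite disjoint_sym.
Qed.

Lemma max_SHF_le (N q : nat) (w w' : seq nat) :
  (1 < size w)%N -> all (leq 1) w -> (1 < size w')%N -> all (leq 1) w' ->
  (forall n (A : 'M['I_q]_(N, n)), is_SHF w A -> is_SHF w' A) ->
  (max_SHF N q w <= max_SHF N q w')%N.
Proof.
move=> w1 w0 w1' w0' ww'; have [[A shfA] _] := max_SHFP N q w1 w0.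
by have [_] := max_SHFP N q w1' w0'; apply; exists A; apply: ww'.
Qed.

Lemma ord3_cases (s : 'I_3) :
  [\/ s = @Ordinal 3 0 isT, s = @Ordinal 3 1 isT | s = @Ordinal 3 2 isT].
Proof.
by case: s => [[|[|[|//]]] ?];
  [constructor 1 | constructor 2 | constructor 3]; apply: val_inj.
Qed.

Lemma ord4_cases (s : 'I_4) : [\/ s = @Ordinal 4 0 isT, s = @Ordinal 4 1 isT,
  s = @Ordinal 4 2 isT | s = @Ordinal 4 3 isT].
Proof.
by case: s => [[|[|[|[|//]]]] ?];
  [constructor 1 | constructor 2 | constructor 3 | constructor 4]; apply: val_inj.
Qed.

(** * Columns with frequent symbols, and the two upper bounds *)

Section Upper.
Variables (N n q : nat) (A : 'M['I_q]_(N, n)).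

Definition popular (m : nat) : {set 'I_n} :=
  [set j | [forall r, m < #|[set k | A r k == A r j]|]%N].

(** Each such column is charged to a rare pair of a row and a symbol; there are [N * q] pairs and
    each is charged at most [m] times. *)
Lemma card_unpopular m : (#|~: popular m| <= N * q * m)%N.
Proof.
pose cls (p : 'I_N * 'I_q) := [set k | A p.1 k == p.2].
apply: (@leq_trans (\sum_(p | #|cls p| <= m) #|cls p|)%N).
  apply: (@leq_trans (\sum_(p | #|cls p| <= m) \sum_(j in cls p) 1)%N).
    rewrite -sum1_card (exchange_big_dep xpredT) //= big_mkcond; apply: leq_sum => j _.
    case: ifP => //; rewrite !inE => /forallPn[r]; rewrite -leqNgt => small.
    by rewrite (bigD1 (r, A r j)) //= inE eqxx andbT.
  by apply: leq_sum => p _; rewrite sum1_card.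
apply: (@leq_trans (\sum_(p : 'I_N * 'I_q) m)%N).
  by rewrite [leqLHS]big_mkcond; apply: leq_sum => p _; case: ifP.
by rewrite sum_nat_const card_prod !card_ord.
Qed.

Lemma popularP m j r (X : {set 'I_n}) : j \in popular m -> (#|X| <= m)%N ->
  exists2 k, k \notin X & A r k = A r j.
Proof.
rewrite inE => /forallP/(_ r) big Xm.
have /subsetPn[k] : ~~ ([set k | A r k == A r j] \subset X).
  by apply/negP => /subset_leq_card; rewrite leqNgt (leq_ltn_trans Xm).
by rewrite inE => /eqP ? ?; exists k.
Qed.

End Upper.

Lemma SHF_111_upper (R : archiRealFieldType) (eps : R) : 0 < eps ->
  exists q0 : nat, forall q n, (q0 <= q)%N ->
    SHF_exists 3 n q [:: 1; 1; 1]%N -> n%:R <= eps * q%:R ^+ 2.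
Proof.
move=> eps0; have eps20 : 0 < eps / 2 by lra.
have [q0 small] := linear_triples_small 1 eps20.
exists (maxn q0 (Num.bound (12 / eps)).+1) => q n; rewrite geq_max => /andP[q0q q1q].
move=> [A /is_SHF_onesP-/(_ isT) shf].
pose i0 : 'I_3 := @Ordinal 3 0 isT; pose i1 : 'I_3 := @Ordinal 3 1 isT.
pose i2 : 'I_3 := @Ordinal 3 2 isT.
have sep x y z : uniq [:: x; y; z] -> 
    exists r, [/\ A r x != A r y, A r x != A r z & A r y != A r z].
  move=> u; have [|r rinj] := shf (fun i => nth x [:: x; y; z] i).
    by move=> i j /eqP; rewrite nth_uniq ?ltn_ord //= => /eqP/val_inj.
  have neq (i j : 'I_3) : i != j -> A r (nth x [:: x; y; z] i) != A r (nth x [:: x; y; z] j).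
    by apply: contra_neq => /rinj.
  by exists r; split; [apply: (neq i0 i1)|apply: (neq i0 i2)|apply: (neq i1 i2)].
pose J := popular A 2.
(* If [j] and [k] agree in two rows, take [z] sharing the symbol of [j] in the third row [t]: no row
   separates [j], [k], [z]. *)
have lin r r' : r != r' -> {in J &, injective (fun j => (A r j, A r' j))}.
  move=> rr' j k jJ kJ [e e']; apply: contraTeq isT => jk.
  have [t tP] : exists t, forall s : 'I_3, [\/ s = r, s = r' | s = t].
    have /cards1P[t tE] : #|~: [set r; r']| == 1%N by rewrite cardsCs setCK cards2 rr' card_ord.
    exists t => s; have : (s \in ~: [set r; r']) = (s == t) by rewrite tE inE.
    rewrite !inE; have [->|_] := eqVneq s r; first by constructor 1.
    have [->|_] := eqVneq s r'; first by constructor 2.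
    by move=> /esym/eqP ->; constructor 3.
  have [|z] := popularP t (X := [set j; k]) jJ; first by rewrite cards2; case: (_ != _).
  rewrite !inE negb_or => /andP[zj zk] ez.
  have [|s []] := sep j k z; first by rewrite /= !inE negb_or jk !(eq_sym _ z) zj zk.
  by case: (tP s) => ->; rewrite ?e ?e' ?ez ?eqxx.
have Jsmall : #|J|%:R < eps / 2 * q%:R ^+ 2.
  (* Another symbol in row 1 would yield columns [c] and [b] such that [j], [c], [b] agree pairwise
     in rows 0, 1 and 2. *)
  apply: (small q _ J (A i0) (A i1) (A i2)) => // [|||j jJ]; try exact: lin.
  apply: leq_trans (_ : #|[set A i1 j]| <= 1)%N; last by rewrite cards1.
  apply/subset_leq_card/subsetP => y; rewrite !inE.
  move=> /andP[/exists_inP[c cJ /andP[/eqP c0 /eqP c1]] /exists_inP[b bJ /andP[/eqP b1 /eqP b2]]].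
  apply: contraTT isT => yj.
  have cj : c != j by apply: contra_neq yj => <-.
  have bj : b != j by apply: contra_neq yj => <-.
  have cb : c != b.
    by apply: contra_neq cj => cb; apply: (lin i0 i2) => //; rewrite c0 cb b2.
  have [|s []] := sep j c b; first by rewrite /= !inE negb_or cb !(eq_sym j) cj bj.
  by case: (ord3_cases s) => ->; rewrite -?/i0 -?/i1 -?/i2 ?c0 ?c1 ?b1 ?b2 ?eqxx.
have nJ : n%:R <= #|J|%:R + q%:R * 6 :> R.
  rewrite -natrM -natrD ler_nat -[leqLHS]card_ord -(cardsC J) leq_add2l.
  by apply: leq_trans (card_unpopular A 2) _; rewrite (_ : 6 = 3 * 2)%N // mulnCA mulnA.
have qpos : 0 < q%:R :> R by rewrite ltr0n (leq_trans _ q1q).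
(* Makes the at most [6 * q] unpopular columns fit into the second half of [eps]. *)
have : 12 / eps < q%:R.
  apply: lt_le_trans (archi_boundP _) _; first by rewrite divr_ge0 // ltW.
  by rewrite ler_nat ltnW.
rewrite ltr_pdivrMr // => q12; nra.
Qed.

Lemma SHF_22_upper (R : archiRealFieldType) (eps : R) : 0 < eps ->
  exists q0 : nat, forall q n, (q0 <= q)%N ->
    SHF_exists 4 n q [:: 2; 2]%N -> n%:R <= eps * q%:R ^+ 2.
Proof.
move=> eps0; have eps40 : 0 < eps / 4 by lra.
have [q1 small1] := linear_triples_small 1 eps40.
have [q3 small3] := linear_triples_small 3 eps40.
exists (maxn (maxn q1 q3) (Num.bound (24 / eps)).+1) => q n.
rewrite !geq_max => /andP[/andP[q1q q3q] q24q] [A shf].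
pose i0 : 'I_4 := @Ordinal 4 0 isT; pose i1 : 'I_4 := @Ordinal 4 1 isT.
pose i2 : 'I_4 := @Ordinal 4 2 isT; pose i3 : 'I_4 := @Ordinal 4 3 isT.
pose J := popular A 3.
(* If [j] and [k] agree in two rows, let [z] share the symbol of [j] in row [t] and [w] that of [k]
   in row [t']: no row separates [j], [w] from [k], [z]. *)
have lin r r' : r != r' -> {in J &, injective (fun j => (A r j, A r' j))}.
  move=> rr' j k jJ kJ [e e']; apply: contraTeq isT => jk.
  have [t [t' tP]] : exists t t', forall s : 'I_4, [\/ s = r, s = r', s = t | s = t'].
    have /cards2P[t [t' [_ tE]]] : #|~: [set r; r']| == 2%N.
      by rewrite cardsCs setCK cards2 rr' card_ord.
    exists t, t' => s.
    have : (s \in ~: [set r; r']) = (s == t) || (s == t') by rewrite tE !inE.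
    rewrite !inE; have [->|_] := eqVneq s r; first by constructor 1.
    have [->|_] := eqVneq s r'; first by constructor 2.
    by move=> /esym/orP[]/eqP ->; [constructor 3 | constructor 4].
  have [|z] := popularP t (X := [set j; k]) jJ; first by rewrite cards2; case: (_ != _).
  rewrite !inE negb_or => /andP[zj zk] ez.
  have [|w] := popularP t' (X := [set j; k; z]) kJ.
    apply: leq_trans (leq_card_setU _ _) _; rewrite cards1 cards2.
    by case: (_ != _).
  rewrite !inE !negb_or => /andP[/andP[wj wk] wz] ew.
  have [|s []] := is_SHF_pairs (x := j) (y := w) (z := k) (t := z) shf.
    by rewrite /= !inE !negb_or jk wk wz !(eq_sym _ z) !(eq_sym _ w) wj zj zk.
  by case: (tP s) => ->; rewrite ?e ?e' ?ez ?ew ?eqxx.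
pose Y1 := joins J (A i0) (A i1) (A i2); pose Y3 := joins J (A i0) (A i3) (A i2).
(* If both sets were larger, completing the symbols of [j] in rows 0 and 2
     through row 1 and through row 3 would give a forbidden 4-cycle. *)
have few j : j \in J -> (#|Y1 j| <= 1)%N || (#|Y3 j| <= 3)%N.
  move=> jJ; rewrite -implyNb -ltnNge; apply/implyP => Y1j.
  have /subsetPn[y yY yj] : ~~ (Y1 j \subset [set A i1 j]).
    by apply/negP => /subset_leq_card; rewrite cards1 leqNgt Y1j.
  move: yY yj; rewrite !inE.
  move=> /andP[/exists_inP[c cJ /andP[/eqP c0 /eqP c1]] /exists_inP[b bJ /andP[/eqP b1 /eqP b2]]] yj.
  have cj : c != j by apply: contra_neq yj => <-.
  have cb : c != b.
    by apply: contra_neq cj => cb; apply: (lin i0 i2) => //; rewrite c0 cb b2.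
  (* A symbol outside these three keeps the columns of the 4-cycle distinct. *)
  apply: (@leq_trans #|[set A i3 j; A i3 c; A i3 b]|); last first.
    apply: leq_trans (leq_card_setU _ _) _; rewrite cards1 cards2.
    by case: (_ != _).
  apply/subset_leq_card/subsetP => x; rewrite !inE.
  move=> /andP[/exists_inP[a aJ /andP[/eqP a0 /eqP a3]] /exists_inP[d dJ /andP[/eqP d3 /eqP d2]]].
  apply: contraTT isT; rewrite !negb_or => /andP[/andP[xj xc] xb].
  have aj : a != j by apply: contra_neq xj => <-.
  have ad : a != d.
    by apply: contra_neq aj => ad; apply: (lin i0 i2) => //; rewrite a0 ad d2.
  have ac : a != c by apply: contra_neq xc => <-.
  have ab : a != b by apply: contra_neq xb => <-.
  have dc : d != c by apply: contra_neq xc => <-.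
  have db : d != b by apply: contra_neq xb => <-.
  (* Around the cycle [a], [c], [b], [d] the neighbors agree in rows 0, 1, 2, 3; the two pairs are
     the opposite columns. *)
  have [|s []] := is_SHF_pairs (x := a) (y := b) (z := c) (t := d) shf.
    by rewrite /= !inE !negb_or ab ac ad (eq_sym b) cb (eq_sym b) db (eq_sym c) dc.
  by case: (ord4_cases s) => ->; rewrite -?/i0 -?/i1 -?/i2 -?/i3
    ?c0 ?c1 ?b1 ?b2 ?a0 ?a3 ?d2 ?d3 ?eqxx.
pose J1 := [set j in J | #|Y1 j| <= 1]%N; pose J3 := [set j in J | #|Y3 j| <= 3]%N.
have J1J : J1 \subset J by apply/subsetP => j; rewrite inE => /andP[].
have J3J : J3 \subset J by apply/subsetP => j; rewrite inE => /andP[].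
have linS (J' : {set 'I_n}) r r' : J' \subset J -> r != r' ->
    {in J' &, injective (fun j => (A r j, A r' j))}.
  by move=> /subsetP sJ rr' j k jJ kJ; apply: lin; rewrite ?sJ.
have J1small : #|J1|%:R < eps / 4 * q%:R ^+ 2.
  apply: (small1 q _ J1 (A i0) (A i1) (A i2)) => // [|||j]; try exact: linS.
  rewrite inE => /andP[_]; apply: leq_trans.
  exact/subset_leq_card/joins_mono.
have J3small : #|J3|%:R < eps / 4 * q%:R ^+ 2.
  apply: (small3 q _ J3 (A i0) (A i3) (A i2)) => // [|||j]; try exact: linS.
  rewrite inE => /andP[_]; apply: leq_trans.
  exact/subset_leq_card/joins_mono.
have nJ : n%:R <= #|J1|%:R + #|J3|%:R + q%:R * 12 :> R.
  rewrite -natrM -!natrD ler_nat -[leqLHS]card_ord -(cardsC J) leq_add //.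
    apply: leq_trans (leq_card_setU J1 J3); apply/subset_leq_card/subsetP => j jJ.
    rewrite in_setU; case/orP: (few j jJ) => h; apply/orP; [left | right];
    by rewrite inE; apply/andP.
  by apply: leq_trans (card_unpopular A 3) _; rewrite (_ : 12 = 4 * 3)%N // mulnCA mulnA.
have qpos : 0 < q%:R :> R by rewrite ltr0n (leq_trans _ q24q).
have : 24 / eps < q%:R.
  apply: lt_le_trans (archi_boundP _) _; first by rewrite divr_ge0 // ltW.
  by rewrite ler_nat ltnW.
rewrite ltr_pdivrMr // => q24; nra.
Qed.

(** * Lower bounds *)

Definition cubic (R : pzRingType) (l : R) := l ^+ 3 - 2 * l ^+ 2 - l + 1.

Lemma cubic_roots (R : rcfType) : exists l1 l2 l3 : R,
  [/\ cubic l1 = 0, cubic l2 = 0 & cubic l3 = 0] /\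
  [/\ l1 < 0, 0 < l2 < 1 & 2 < l3 < 3].
Proof.
pose p : {poly R} := 'X^3 - 2%:P * 'X^2 - 'X + 1%:P.
have pE x : p.[x] = cubic x by rewrite /p /cubic !hornerE.
have [||l1 /andP[a1 b1] /rootP] := @poly_ivt _ p (-1) 0; rewrite ?pE /cubic; first by lra.
  by apply/andP; split; lra.
(* On [[0, 1]] the cubic falls from 1 to -1, hence the sign change. *)
move=> r1; have [||l2 /andP[a2 b2] /rootP] := @poly_ivt _ (- p) 0 1; first by lra.
  by rewrite !hornerN !pE /cubic; apply/andP; split; lra.
rewrite hornerN pE /cubic => r2.
have [||l3 /andP[a3 b3] /rootP] := @poly_ivt _ p 2 3; rewrite ?pE /cubic; first by lra.
  by apply/andP; split; lra.
move=> r3; have r2' : l2 ^+ 3 - 2 * l2 ^+ 2 - l2 + 1 = 0 by lra.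
exists l1, l2, l3; split=> //; split.
- by rewrite lt_neqAle b1 andbT; apply/eqP => e; move: r1; rewrite e; lra.
- apply/andP; split; rewrite lt_neqAle ?a2 ?b2 andbT; apply/eqP.
    by move/esym => e; move: r2'; rewrite e; lra.
  by move=> e; move: r2'; rewrite e; lra.
- apply/andP; split; rewrite lt_neqAle ?a3 ?b3 andbT; apply/eqP.
    by move/esym => e; move: r3; rewrite e; lra.
  by move=> e; move: r3; rewrite e; lra.
Qed.

(* The determinant of multiplication by [a + b l + c l^2] in the basis
   [1, l, l^2], where [l] is a root of the cubic. *)
Definition cubic_norm (R : comPzRingType) (a b c : R) :=
  a * ((a + c) * (a + 2 * b + 5 * c) - (b + 2 * c) * (b + c))
  - b * (- c * (a + 2 * b + 5 * c) + (b + 2 * c) * (b + 2 * c))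
  + c * (- c * (b + c) + (a + c) * (b + 2 * c)).

(** Multiplying the relation by [l] and [l ^+ 2] shows that a matrix with determinant
    [cubic_norm a b c] kills [(1, l, l ^+ 2)]; the cofactors of its first column then produce the
    determinant. *)
Lemma cubic_norm_eq0 (R : comPzRingType) (l a b c : R) : cubic l = 0 ->
  a + b * l + c * l ^+ 2 = 0 -> cubic_norm a b c = 0.
Proof.
rewrite /cubic => f0 e0.
have e1 : - c + (a + c) * l + (b + 2 * c) * l ^+ 2 = 0.
  transitivity ((a + b * l + c * l ^+ 2) * l - c * (l ^+ 3 - 2 * l ^+ 2 - l + 1)).
    by ring.
  by rewrite e0 f0; ring.
have e2 : - (b + 2 * c) + (b + c) * l + (a + 2 * b + 5 * c) * l ^+ 2 = 0.
  transitivity ((- c + (a + c) * l + (b + 2 * c) * l ^+ 2) * l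
    - (b + 2 * c) * (l ^+ 3 - 2 * l ^+ 2 - l + 1)); first by ring.
  by rewrite e1 f0; ring.
transitivity (
   ((a + c) * (a + 2 * b + 5 * c) - (b + 2 * c) * (b + c)) * (a + b * l + c * l ^+ 2)
   - (b * (a + 2 * b + 5 * c) - c * (b + c)) * (- c + (a + c) * l + (b + 2 * c) * l ^+ 2)
   + (b * (b + 2 * c) - c * (a + c)) *
     (- (b + 2 * c) + (b + c) * l + (a + 2 * b + 5 * c) * l ^+ 2)).
  by rewrite /cubic_norm; ring.
by rewrite e0 e1 e2; ring.
Qed.

(** Modulo 2 the cubic is the irreducible [l^3 + l + 1], so this is the norm form of the field with
    8 elements. *)
Lemma cubic_norm_F2 (a b c : 'F_2) : cubic_norm a b c = 0 -> [/\ a = 0, b = 0 & c = 0].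
Proof.
have F2 (x : 'F_2) : x = 0 \/ x = 1.
  by case: x => [[|[|//]] ?]; [left | right]; apply: val_inj.
by case: (F2 a) => ->; case: (F2 b) => ->; case: (F2 c) => ->.
Qed.

Lemma intr_F2 (a : int) : a%:~R = 0 :> 'F_2 -> exists a', a = 2 * a'.
Proof.
move=> a0; have /dvdzP[a' ->] : (2 %| a)%Z; last by exists a'; rewrite mulrC.
case: a a0 => n; rewrite ?NegzE ?rmorphN /= => /eqP; rewrite ?oppr_eq0.
  by rewrite -pmulrn -(@dvdn_pcharf _ 2) // pchar_Fp.
by rewrite dvdzE abszN /= -pmulrn -(@dvdn_pcharf _ 2) // pchar_Fp.
Qed.

(* Infinite descent: the norm form has no nontrivial zero modulo 2. *)
Lemma cubic_free (R : realDomainType) (l : R) (a b c : int) : cubic l = 0 ->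
  a%:~R + b%:~R * l + c%:~R * l ^+ 2 = 0 -> [/\ a = 0, b = 0 & c = 0].
Proof.
move=> l0; have [m] := ubnP (`|a| + `|b| + `|c|)%N.
elim: m a b c => // m IHm a b c small e0.
have normR (S : comPzRingType) : cubic_norm (a%:~R : S) b%:~R c%:~R = (cubic_norm a b c)%:~R.
  by rewrite /cubic_norm !(rmorphD, rmorphB, rmorphM, rmorphN).
have n0 : cubic_norm a b c = 0.
  by apply/eqP; rewrite -(intr_eq0 R) -normR; apply/eqP/(cubic_norm_eq0 l0).
have [/intr_F2[a' aE] /intr_F2[b' bE] /intr_F2[c' cE]] :
    [/\ a%:~R = 0 :> 'F_2, b%:~R = 0 :> 'F_2 & c%:~R = 0 :> 'F_2].
  by apply: cubic_norm_F2; rewrite normR n0.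
have e' : a'%:~R + b'%:~R * l + c'%:~R * l ^+ 2 = 0.
  by move: e0; rewrite aE bE cE !rmorphM /=; lra.
have [z|nz] := boolP [&& a' == 0, b' == 0 & c' == 0].
  by case/and3P: z => /eqP a0 /eqP b0 /eqP c0; rewrite aE bE cE a0 b0 c0.
have [|a0 b0 c0] := IHm a' b' c' _ e'; last by rewrite aE bE cE a0 b0 c0.
move: small nz; rewrite aE bE cE; lia.
Qed.

(** [D] is a convex combination of the other points; as all norms agree, the weighted sum of their
    squared distances to [D] expands to 0. *)
Lemma convex_sphere (R : realDomainType) (d : nat) (A B C D : 'I_d -> R) (wA wB wC s : R) :
  0 < wA -> 0 <= wB -> 0 <= wC ->
  (forall j, wA * A j + wB * B j + wC * C j = (wA + wB + wC) * D j) ->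
  \sum_j A j ^+ 2 = s -> \sum_j B j ^+ 2 = s -> \sum_j C j ^+ 2 = s ->
  \sum_j D j ^+ 2 = s -> forall j, A j = D j.
Proof.
move=> A0 B0 C0 lin sA sB sC sD.
pose F j := wA * (A j - D j) ^+ 2 + wB * (B j - D j) ^+ 2 + wC * (C j - D j) ^+ 2.
have F0 j : 0 <= F j by rewrite !addr_ge0 // mulr_ge0 ?sqr_ge0 // ltW.
have sF : \sum_j F j = 0.
  transitivity (wA * (\sum_j A j ^+ 2) + wB * (\sum_j B j ^+ 2) +
      wC * (\sum_j C j ^+ 2) - (wA + wB + wC) * (\sum_j D j ^+ 2)).
    rewrite !mulr_sumr -!big_split -sumrB /=; apply: eq_bigr => j _; rewrite /F.
    have := congr1 (fun x => x * (2 * D j)) (lin j) => /= e.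
    rewrite -[RHS]subr0 -{1}(subrr ((wA + wB + wC) * D j * (2 * D j))) -{1}e; ring.
  by rewrite sA sB sC sD; ring.
move=> j; have Fj : F j = 0 by apply: (psumr_eq0P _ sF) => // i _; exact: F0.
have : wA * (A j - D j) ^+ 2 == 0.
  rewrite eq_le (mulr_ge0 (ltW A0) (sqr_ge0 _)) andbT -Fj /F -addrA lerDl.
  by rewrite addr_ge0 // mulr_ge0 ?sqr_ge0.
by rewrite mulf_eq0 gt_eqF //= sqrf_eq0 subr_eq0 => /eqP.
Qed.

(** * Digit vectors over Z[l], their codes and Gram matrices *)

Section Construction.
Variables (d b : nat).
Local Notation X := {ffun 'I_d * 'I_3 -> 'I_b}.
Let t0 : 'I_3 := @Ordinal 3 0 isT.
Let t1 : 'I_3 := @Ordinal 3 1 isT.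
Let t2 : 'I_3 := @Ordinal 3 2 isT.

(** The digits are coordinates in the basis [1, l, l ^+ 2] of Z[l]; [l] selects the real
    embedding. *)
Definition emb (R : pzRingType) (l : R) (x : X) (j : 'I_d) : R :=
  (x (j, t0))%:R + (x (j, t1))%:R * l + (x (j, t2))%:R * l ^+ 2.

Lemma emb_inj (R : realDomainType) (l : R) (x y : X) :
  cubic l = 0 -> (forall j, emb l x j = emb l y j) -> x = y.
Proof.
move=> l0 e; apply/ffunP => -[j t].
have [] := @cubic_free R l ((x (j, t0))%:Z - (y (j, t0))%:Z)
  ((x (j, t1))%:Z - (y (j, t1))%:Z) ((x (j, t2))%:Z - (y (j, t2))%:Z) l0.
  by have := e j; rewrite /emb !rmorphB /= -!pmulrn; lra.
move=> /eqP + /eqP + /eqP; rewrite !subr_eq0 !eqz_nat => /eqP e0 /eqP e1 /eqP e2.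
by apply: val_inj; case: (ord3_cases t) => ->.
Qed.

(* The slopes [0, 1, l, 3]; the row of slope [a] contains [x + a s]. *)
Definition slope (R : pzRingType) (l : R) (r : nat) : R := nth 0 [:: 0; 1; l; 3] r.

(* The digits of [l s], shifted by [b] so as to be nonnegative. *)
Definition times_root (s : X) (jt : 'I_d * 'I_3) : nat :=
  match nat_of_ord jt.2 with
  | 0 => b - s (jt.1, t2)
  | 1 => s (jt.1, t0) + s (jt.1, t2)
  | _ => s (jt.1, t1) + 2 * s (jt.1, t2)
  end%N.

Definition digit (r : nat) (p : X * X) (jt : 'I_d * 'I_3) : nat :=
  match r with
  | 0 => p.1 jt
  | 1 => p.1 jt + p.2 jt
  | 2 => p.1 jt + times_root p.2 jt
  | _ => p.1 jt + 3 * p.2 jt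
  end%N.

Lemma digit_lt r p jt : (digit r p jt < 4 * b)%N.
Proof.
have lt1 i := ltn_ord (p.1 i); have lt2 i := ltn_ord (p.2 i).
case: jt => j t; have := lt1 (j, t); have := lt2 (j, t).
have := lt2 (j, t0); have := lt2 (j, t1); have := lt2 (j, t2).
case: r => [|[|[|r]]] /=; try lia.
by rewrite /times_root /=; case: (nat_of_ord t) => [|[|?]]; lia.
Qed.

Definition code (r : nat) (p : X * X) : {ffun 'I_d * 'I_3 -> 'I_(4 * b)} :=
  [ffun jt => Ordinal (digit_lt r p jt)].

Lemma code_eq (R : comPzRingType) (l : R) r p p' : (r < 4)%N -> cubic l = 0 ->
  code r p = code r p' -> forall j,
  emb l p.1 j + slope l r * emb l p.2 j = emb l p'.1 j + slope l r * emb l p'.2 j.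
Proof.
move=> r4 l0 e j.
have dig t : digit r p (j, t) = digit r p' (j, t).
  by have /ffunP/(_ (j, t)) := e; rewrite !ffunE => -[].
pose num (q : X * X) : R :=
  (digit r q (j, t0))%:R + (digit r q (j, t1))%:R * l + (digit r q (j, t2))%:R * l ^+ 2.
(* Codes are integral, so their equality can be read at any root; the shift by [b] in row 2
   cancels. *)
suff numE q : num q = (if r == 2 then b%:R else 0) + (emb l q.1 j + slope l r * emb l q.2 j).
  by apply: (addrI (if r == 2 then b%:R else 0)); rewrite -!numE /num !dig.
rewrite /num /emb /slope; case: r r4 {e dig num} => [|[|[|[|//]]]] _ /=; rewrite ?natrD ?natrM; try ring.
rewrite /times_root /= natrB ?(ltnW (ltn_ord _)) //.
apply/eqP; rewrite -subr_eq0 -(mulr0 (- (q.2 (j, t2))%:R)) -[X in _ == _ * X]l0 /cubic.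
by apply/eqP; ring.
Qed.

(** The integral Gram matrix fixes the norm of [s] at all roots at once. Its entries are at most
    [d * b ^ 2], so [inord] is faithful. *)
Definition gram (s : X) : {ffun 'I_3 * 'I_3 -> 'I_(d * b ^ 2).+1} :=
  [ffun tu => inord (\sum_(j < d) s (j, tu.1) * s (j, tu.2))].

Lemma gram_sphere (R : comPzRingType) (l : R) s s' : gram s = gram s' ->
  \sum_j emb l s j ^+ 2 = \sum_j emb l s' j ^+ 2.
Proof.
move=> e.
pose g (x : X) t u : nat := (\sum_(j < d) x (j, t) * x (j, u))%N.
have gb x t u : (g x t u < (d * b ^ 2).+1)%N.
  rewrite ltnS -[X in (X * _)%N]card_ord -sum_nat_const; apply: leq_sum => j _.
  by rewrite leq_mul // ltnW.
have gE t u : g s t u = g s' t u.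
  have /ffunP/(_ (t, u)) := e; rewrite !ffunE /= -/(g s t u) -/(g s' t u).
  by move=> /(congr1 (@nat_of_ord _)); rewrite !inordK.
suff sE (x : X) : \sum_j emb l x j ^+ 2 = (g x t0 t0)%:R + 2 * l * (g x t0 t1)%:R
    + l ^+ 2 * (2 * (g x t0 t2)%:R + (g x t1 t1)%:R)
    + 2 * l ^+ 3 * (g x t1 t2)%:R + l ^+ 4 * (g x t2 t2)%:R.
  by rewrite !sE !gE.
rewrite /g !natr_sum !(mulr_sumr, =^~ big_split) /=; apply: eq_bigr => j _.
by rewrite /emb !natrM; ring.
Qed.
End Construction.

(** * Cycles of columns agreeing in rows of increasing slope *)

Section RainbowCycles.
Variables (R : rcfType) (d b : nat).
Local Notation X := {ffun 'I_d * 'I_3 -> 'I_b}.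
Implicit Types (p : X * X) (l : R).

Lemma code_emb_inj l r p p' : (r < 4)%N -> cubic l = 0 -> code r p = code r p' ->
  (forall j, emb l p.2 j = emb l p'.2 j) -> p = p'.
Proof.
move=> r4 l0 e e2; have e1 j : emb l p.1 j = emb l p'.1 j.
  by have := code_eq r4 l0 e j; rewrite e2 => /addIr.
by rewrite [p]surjective_pairing [p']surjective_pairing (emb_inj l0 e1) (emb_inj l0 e2).
Qed.

(** Two equations with distinct slopes determine both components; at the root in (2, 3) the four
    slopes differ. *)
Lemma code_linear r r' p p' : (r < 4)%N -> (r' < 4)%N -> r != r' ->
  code r p = code r p' -> code r' p = code r' p' -> p = p'.
Proof.
move=> r4 r4' rr' e e'.
have [_ [_ [l [[_ _ l0] [_ _ /andP[l2 l3]]]]]] := cubic_roots R.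
apply: (code_emb_inj r4 l0 e) => j.
have s : slope l r - slope l r' != 0.
  have l20 : l - 1 != 0 by apply/eqP; lra.
  have l30 : l - 3 != 0 by apply/eqP; lra.
  have l00 : l != 0 by apply/eqP; lra.
  rewrite /slope; case: r r' r4 r4' rr' {e e'} => [|[|[|[|//]]]] [|[|[|[|//]]]] //= _ _ _;
  by apply/eqP; lra.
apply: (mulfI s).
have := code_eq r4 l0 e j; have := code_eq r4' l0 e' j; lra.
Qed.

(** Summing the three equations around the cycle cancels the first components and makes the second
    component of [pC] a convex combination of those of [pA] and [pB]. [convex_sphere] gets [pB]
    twice, once with weight 0. *)
Lemma triangle_trivial l i j k (pA pB pC : X * X) :
  (i < 4)%N -> (j < 4)%N -> (k < 4)%N -> cubic l = 0 ->
  slope l k < slope l i -> slope l i < slope l j ->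
  gram pA.2 = gram pC.2 -> gram pB.2 = gram pC.2 ->
  code k pC = code k pA -> code i pA = code i pB -> code j pB = code j pC -> pC = pA.
Proof.
move=> i4 j4 k4 l0 ki ij gA gB ek ei ej.
apply: (code_emb_inj k4 l0 ek) => t; apply/esym.
apply: (@convex_sphere _ _ (emb l pA.2) (emb l pB.2) (emb l pB.2) (emb l pC.2)
  (slope l i - slope l k) (slope l j - slope l i) 0 _ _ _ _ _ (gram_sphere l gA)
  (gram_sphere l gB) (gram_sphere l gB) erefl); try lra.
move=> {}t; have := code_eq k4 l0 ek t; have := code_eq i4 l0 ei t.
have := code_eq j4 l0 ej t; lra.
Qed.

Lemma quadrangle_trivial l i j k m (pA pB pC pD : X * X) :
  (i < 4)%N -> (j < 4)%N -> (k < 4)%N -> (m < 4)%N -> cubic l = 0 ->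
  slope l m < slope l i -> slope l i < slope l j -> slope l j < slope l k ->
  gram pA.2 = gram pD.2 -> gram pB.2 = gram pD.2 -> gram pC.2 = gram pD.2 ->
  code m pD = code m pA -> code i pA = code i pB -> code j pB = code j pC ->
  code k pC = code k pD -> pD = pA.
Proof.
move=> i4 j4 k4 m4 l0 mi ij jk gA gB gC em ei ej ek.
apply: (code_emb_inj m4 l0 em) => t; apply/esym.
apply: (@convex_sphere _ _ (emb l pA.2) (emb l pB.2) (emb l pC.2) (emb l pD.2)
  (slope l i - slope l m) (slope l j - slope l i) (slope l k - slope l j) _ _ _ _ _
  (gram_sphere l gA) (gram_sphere l gB) (gram_sphere l gC) erefl); try lra.
move=> {}t; have := code_eq k4 l0 ek t; have := code_eq i4 l0 ei t.
have := code_eq j4 l0 ej t; have := code_eq m4 l0 em t; lra.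
Qed.

End RainbowCycles.

(** * Finite check: the collision graph contains a suitable cycle *)

Definition joined (e : nat * nat) u v := (e == (u, v)) || (e == (v, u)).

(** Entry [r] of [es] is the edge of row [r]. The default [head 0 p] closes the walk, and [take]
    lets a walk of length 3 use part of a permutation of four vertices. *)
Definition closed_walk (rows p : seq nat) (es : seq (nat * nat)) :=
  all (fun i => joined (nth (0, 0) es (nth 0 rows i)) (nth 0 p i)
                       (nth (head 0 p) (take (size rows) p) i.+1))%N (iota 0 (size rows)).

(* For a suitable root of the cubic, the slopes increase along each list: the
   last three lists are the orders of [0, 1, l, 3] for the three roots, and
   represent the three cyclic orders up to rotation and reflection. *)
Definition increasing_rows : seq (seq nat) :=
  [:: [:: 0; 1; 2]; [:: 0; 1; 3]; [:: 0; 2; 3]; [:: 1; 2; 3];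
      [:: 2; 0; 1; 3]; [:: 0; 2; 1; 3]; [:: 0; 1; 2; 3]]%N.

Definition has_increasing_walk es :=
  has (fun rows => has (fun p => closed_walk rows p es) (permutations (iota 0 4)))
    increasing_rows.

Definition pairs_below N : seq (nat * nat) :=
  [seq e <- [seq (u, v) | u <- iota 0 N, v <- iota 0 N] | e.1 < e.2]%N.

Definition seqs_over (T : Type) (s : seq T) n : seq (seq T) :=
  iter n (fun L => [seq a :: t | a <- s, t <- L]) [:: [::]].

Lemma mem_seqs_over (T : eqType) (s t : seq T) : {subset t <= s} ->
  t \in seqs_over s (size t).
Proof.
elim: t => //= a t IHt ats; apply/allpairsP; exists (a, t); split=> //=.
  by rewrite ats // mem_head.
by apply: IHt => x xt; rewrite ats // inE xt orbT.
Qed.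

(** With [N] distinct edges on [N] vertices there is a cycle, of length 3 or 4; that it can be read
    along one of the listed row orders is checked exhaustively. *)
Lemma edges_have_walk N es : (N == 3) || (N == 4) -> size es = N ->
  {subset es <= pairs_below N} -> ~~ uniq es || has_increasing_walk es.
Proof.
have chk3 : all (fun es => ~~ uniq es || has_increasing_walk es)
    (seqs_over (pairs_below 3) 3) by vm_compute.
have chk4 : all (fun es => ~~ uniq es || has_increasing_walk es)
    (seqs_over (pairs_below 4) 4) by vm_compute.
move=> N34 sN /mem_seqs_over; rewrite {}sN.
by case/orP: N34 => /eqP ->; [apply: (allP chk3) | apply: (allP chk4)].
Qed.

Lemma no_rainbow (R : rcfType) (d b N : nat) (es : seq (nat * nat))
    (g : nat -> {ffun 'I_d * 'I_3 -> 'I_b} * {ffun 'I_d * 'I_3 -> 'I_b}) :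
  (N == 3) || (N == 4) -> size es = N -> {subset es <= pairs_below N} ->
  (forall r, (r < N)%N ->
    code r (g (nth (0, 0) es r).1) = code r (g (nth (0, 0) es r).2))%N ->
  {in gtn N &, injective g} ->
  {in gtn N &, forall u v, gram (g u).2 = gram (g v).2} -> False.
Proof.
move=> N34 sN esN agree ginj ggram.
have N4 : (N <= 4)%N by case/orP: N34 => /eqP ->.
have edgeP r : (r < N)%N -> let e := nth (0, 0)%N es r in
    [/\ (e.1 < N)%N, (e.2 < N)%N & (e.1 < e.2)%N].
  move=> rN /=; have := esN _ (mem_nth (0, 0)%N (_ : (r < size es)%N)).
  rewrite sN => /(_ rN); rewrite mem_filter => /andP[lt12 /allpairsP[[u v] [/= + + e]]].
  by rewrite !mem_iota e /= in lt12 * => /= uN vN.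
(* A repeated edge means two columns agreeing in two rows, which [code_linear] excludes. *)
have /orP[/(uniqPn (0, 0)%N)[r [r' [rr']]]|] := edges_have_walk N34 sN esN.
  rewrite sN => r'N e; have rN := ltn_trans rr' r'N.
  have := agree r rN; have := agree r' r'N; rewrite -e => e2 e1.
  have [u v uv] := edgeP r rN.
  have := code_linear R (leq_trans rN N4) (leq_trans r'N N4) _ e1 e2.
  by rewrite neq_ltn rr' => /(_ isT)/ginj => /(_ u v) euv; rewrite euv ltnn in uv.
(* Rows from [N] on read the default edge [(0, 0)], which joins no two distinct vertices. *)
have link r u v : joined (nth (0, 0)%N es r) u v -> u != v ->
    [/\ (r < 4)%N, (u < N)%N, (v < N)%N & code r (g u) = code r (g v)].
  have [rN|rN] := ltnP r N; last first.
    by rewrite nth_default ?sN // => /orP[]/eqP[<- <-]; rewrite eqxx.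
  have := agree r rN; have [] := edgeP r rN; case: (nth _ _ _) => u' v' /= uN vN _ e.
  by move=> /orP[]/eqP[<- <-] _; split=> //; apply: leq_trans rN N4.
have [l1 [l2 [l3 [[l10 l20 l30] [l1lt /andP[l2gt l2lt] /andP[l3gt l3lt]]]]]] := cubic_roots R.
move=> /hasP[rows rowsin /hasP[p]]; rewrite mem_permutations => pP.
have := perm_uniq pP; have := perm_size pP => /=.
case: p {pP} => [|x [|y [|z [|t []]]]] //= _.
rewrite !inE !negb_or => /and4P[/and3P[xy xz xt] /andP[yz yt] zt _].
have yx : y != x by rewrite eq_sym.
have zx : z != x by rewrite eq_sym.
have tx : t != x by rewrite eq_sym.
have triangle i j k : closed_walk [:: k; i; j] [:: x; y; z; t] es ->
    slope l3 k < slope l3 i -> slope l3 i < slope l3 j -> False.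
  rewrite /closed_walk /= andbT.
  move=> /and3P[/link-/(_ xy)[k4 xN yN ek] /link-/(_ yz)[i4 _ zN ei] /link-/(_ zx)[j4 _ _ ej]].
  move=> ki ij; have := triangle_trivial i4 j4 k4 l30 ki ij (ggram _ _ yN xN) (ggram _ _ zN xN) ek ei ej.
  by move=> /ginj-/(_ xN yN)/eqP; rewrite (negbTE xy).
have quadrangle (l : R) i j k m : closed_walk [:: m; i; j; k] [:: x; y; z; t] es -> cubic l = 0 ->
    slope l m < slope l i -> slope l i < slope l j -> slope l j < slope l k -> False.
  rewrite /closed_walk /= andbT.
  move=> /and4P[/link-/(_ xy)[m4 xN yN em] /link-/(_ yz)[i4 _ zN ei] /link-/(_ zt)[j4 _ tN ej]
    /link-/(_ tx)[k4 _ _ ek]] l0 mi ij jk.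
  have := quadrangle_trivial i4 j4 k4 m4 l0 mi ij jk (ggram _ _ yN xN) (ggram _ _ zN xN)
    (ggram _ _ tN xN) em ei ej ek.
  by move=> /ginj-/(_ xN yN)/eqP; rewrite (negbTE xy).
move: rowsin; rewrite !inE.
(* At [l3] the slopes of rows 0, 1, 2, 3 increase, so every triangle is handled there; only
   quadrangles use [l1] and [l2]. *)
case/orP=> [/eqP->|]; first by move/triangle; apply; rewrite /slope /=; lra.
case/orP=> [/eqP->|]; first by move/triangle; apply; rewrite /slope /=; lra.
case/orP=> [/eqP->|]; first by move/triangle; apply; rewrite /slope /=; lra.
case/orP=> [/eqP->|]; first by move/triangle; apply; rewrite /slope /=; lra.
case/orP=> [/eqP->|]; first by move/quadrangle => /(_ l1 l10); apply; rewrite /slope /=; lra.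
case/orP=> [/eqP->|/eqP->]; first by move/quadrangle => /(_ l2 l20); apply; rewrite /slope /=; lra.
by move/quadrangle => /(_ l3 l30); apply; rewrite /slope /=; lra.
Qed.

(** * The hash family and its number of columns *)

Section Counting.
Variables (R : rcfType) (d b : nat).
Local Notation X := {ffun 'I_d * 'I_3 -> 'I_b}.

Lemma perfect_hashing (N q : nat) (S : {set X}) : (N == 3) || (N == 4) ->
  {in S &, forall s s', gram s = gram s'} -> ((4 * b) ^ (3 * d) <= q)%N ->
  exists A : 'M['I_q]_(N, #|setX [set: X] S|),
    forall f : 'I_N -> 'I_#|setX [set: X] S|, injective f ->
      exists r, injective (fun i => A r (f i)).
Proof.
move=> N34 sphere alph.
have N0 : (0 < N)%N by case/orP: N34 => /eqP ->.
have cq : (#|{ffun 'I_d * 'I_3 -> 'I_(4 * b)}| <= q)%N.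
  by rewrite card_ffun card_prod !card_ord (mulnC d).
pose P := setX [set: X] S.
exists (\matrix_(r < N, j < #|P|) widen_ord cq (enum_rank (code r (enum_val j : X * X)))).
move=> f finj.
have [/existsP[r /injectiveP rinj]|] := boolP [exists r : 'I_N,
    injectiveb (fun i => code r (enum_val (f i) : X * X))].
  exists r => i j; rewrite !mxE => /(congr1 (@nat_of_ord _)) /= /val_inj /enum_rank_inj.
  exact: rinj.
move=> /existsPn none.
have /fin_all_exists[e eP] (r : 'I_N) : exists e : 'I_N * 'I_N,
    (e.1 < e.2)%N /\ code r (enum_val (f e.1) : X * X) = code r (enum_val (f e.2) : X * X).
  have /injectivePn[i [j ij eij]] := none r.
  have [lt|gt|/val_inj eq] := ltngtP i j; first by exists (i, j).
    by exists (j, i).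
  by rewrite eq eqxx in ij.
(* Extends the columns to all naturals; only indices below [N] are used. *)
pose g (u : nat) : X * X := enum_val (f (insubd (Ordinal N0) u)).
have gE (i : 'I_N) : g i = enum_val (f i) by rewrite /g valKd.
exfalso; apply: (@no_rainbow R d b N
  [seq (nat_of_ord (e r).1, nat_of_ord (e r).2) | r <- enum 'I_N] g N34).
- by rewrite size_map size_enum_ord.
- move=> _ /mapP[r _ ->]; have [lt _] := eP r.
  rewrite mem_filter lt /=; apply/allpairsP; exists (nat_of_ord (e r).1, nat_of_ord (e r).2).
  by rewrite !mem_iota !ltn_ord.
- move=> r rN; rewrite (nth_map (Ordinal rN)) ?size_enum_ord //=.
  rewrite (_ : nth _ _ r = Ordinal rN); last exact: (nth_ord_enum _ (Ordinal rN)).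
  by rewrite !gE; have [_] := eP (Ordinal rN).
- move=> u v uN vN; rewrite -[u]/(nat_of_ord (Ordinal uN)) -[v]/(nat_of_ord (Ordinal vN)) !gE.
  by move=> /enum_val_inj/finj ->.
- move=> u v _ _; have inS w : (g w).2 \in S.
    by have := enum_valP (f (insubd (Ordinal N0) w)); rewrite inE => /andP[].
  exact: sphere.
Qed.

End Counting.

Lemma large_fiber (X G : finType) (h : X -> G) : (0 < #|G|)%N ->
  exists g, (#|X| <= #|[set s | h s == g]| * #|G|)%N.
Proof.
move=> G0; apply/existsP; apply: contraT => /existsPn small.
have : (\sum_(g : G) (#|[set s | h s == g]| * #|G|).+1 <= \sum_(g : G) #|X|)%N.
  by apply: leq_sum => g _; rewrite ltnNge small.
under eq_bigr do rewrite -addn1.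
rewrite big_split /= -big_distrl /= !sum_nat_const muln1.
have -> : (\sum_(g : G) #|[set s | h s == g]| = #|X|)%N.
  rewrite -[RHS]sum1_card (partition_big h xpredT) //=; apply: eq_bigr => g _.
  by rewrite -sum1_card; apply: eq_bigl => x; rewrite inE.
by rewrite mulnC leqNgt -{1}[(#|G| * _)%N]addn0 ltn_add2l G0.
Qed.

(** The first component ranges over all [b ^ (3 * d)] vectors, the second over a most frequent Gram
    class, which costs a factor of one ninth power for the nine entries. *)
Lemma max_SHF_ones_lower (R : rcfType) (d b N q : nat) : (N == 3) || (N == 4) ->
  ((4 * b) ^ (3 * d) <= q)%N ->
  (b ^ (6 * d) <= max_SHF N q (nseq N 1) * (d * b ^ 2).+1 ^ 9)%N.
Proof.
move=> N34 alph.
have [|g gP] := @large_fiber _ _ (@gram d b).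
  by rewrite card_ffun !card_prod !card_ord expn_gt0.
set S := [set s | gram s == g] in gP.
have [|A AP] := @perfect_hashing R d b N q S N34 _ alph.
  by move=> s s'; rewrite !inE => /eqP -> /eqP ->.
have SHF : SHF_exists N #|setX [set: {ffun 'I_d * 'I_3 -> 'I_b}] S| q (nseq N 1).
  by exists A; case/orP: N34 A AP => /eqP -> A AP; apply/is_SHF_onesP.
have le : (#|setX [set: {ffun 'I_d * 'I_3 -> 'I_b}] S| <= max_SHF N q (nseq N 1))%N.
  have [||_] := @max_SHFP N q (nseq N 1); last exact.
    by case/orP: N34 => /eqP ->.
  by rewrite all_nseq orbT.
have cX : #|{ffun 'I_d * 'I_3 -> 'I_b}| = (b ^ (3 * d))%N.
  by rewrite card_ffun card_prod !card_ord (mulnC d).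
have cG : #|{ffun 'I_3 * 'I_3 -> 'I_(d * b ^ 2).+1}| = ((d * b ^ 2).+1 ^ 9)%N.
  by rewrite card_ffun card_prod !card_ord.
rewrite cX cG in gP.
apply: leq_trans (leq_mul le (leqnn _)); rewrite cardsX cardsT -mulnA.
rewrite (_ : (6 * d = 3 * d + 3 * d)%N); last by rewrite -mulnDl.
by rewrite expnD cX leq_mul2l gP orbT.
Qed.

(** * Asymptotics *)

From mathcomp Require Import boolp classical_sets reals.
From mathcomp Require Import topology normedtype landau exp.
Import numFieldNormedType.Exports.
Local Open Scope classical_set_scope.
Local Open Scope ring_scope.

Section Asymptotics.
Variables (R : realType) (M : nat -> nat).
Hypothesis M_upper : forall eps : R, 0 < eps ->
  exists q0 : nat, forall q, (q0 <= q)%N -> (M q)%:R <= eps * q%:R ^+ 2.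

Lemma quadratic_littleo :
  (fun q => (M q)%:R : R^o) =o_\oo (fun q : nat => (q%:R : R) ^+ 2 : R^o).
Proof.
apply/eqoP => eps eps0; have [q0 q0P] := M_upper eps0.
exists q0 => // q /= qq0; rewrite normr_nat ger0_norm ?exprn_ge0 //.
exact: q0P.
Qed.

Hypothesis M_lower : forall d b q, ((4 * b) ^ (3 * d) <= q)%N ->
  (b ^ (6 * d) <= M q * (d * b ^ 2).+1 ^ 9)%N.

(** Take [b] maximal for the alphabet, so that [4 * b.+1 <= 8 * b] bounds [q]. Of the 20 lost powers
    of [b], the Gram classes cost 18 and the last two absorb the constant [K]. *)
Lemma lower_nat d : (4 <= d)%N -> exists q0 : nat, forall q, (q0 <= q)%N ->
  exists2 b, (q <= (8 * b) ^ (3 * d))%N & ((8 * b) ^ (6 * d - 20) < M q)%N.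
Proof.
move=> d4; have d0 : (0 < 3 * d)%N by lia.
have [K KE] : exists K, K = (8 ^ (6 * d - 20) * d.+1 ^ 9)%N by eexists.
exists ((4 * K.+1) ^ (3 * d))%N => q qK.
have bnd b : ((4 * b) ^ (3 * d) <= q)%N -> (b <= q)%N.
  apply: leq_trans; apply: (@leq_trans (4 * b)%N); first by rewrite leq_pmull.
  case: b => [|b]; first by rewrite muln0.
  by rewrite -[leqLHS]expn1 leq_pexp2l.
have exb : exists b, ((4 * b) ^ (3 * d) <= q)%N by exists K.+1.
have [b bq bmax] := ex_maxnP exb bnd.
have Kb : (K < b)%N by apply: bmax.
have b0 : (0 < b)%N := leq_ltn_trans (leq0n K) Kb.
have qb : (q < (4 * b.+1) ^ (3 * d))%N.
  by rewrite ltnNge; apply/negP => /bmax; rewrite ltnn.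
exists b; first by apply: ltnW; apply: leq_trans qb _; rewrite leq_exp2r // mulnS; clear -Kb; lia.
have Mb : (b ^ 18 * (b ^ (6 * d - 20) * b ^ 2) <= b ^ 18 * (M q * d.+1 ^ 9))%N.
  have -> : (b ^ 18 * (b ^ (6 * d - 20) * b ^ 2) = b ^ (6 * d))%N.
    by rewrite -!expnD; congr (_ ^ _)%N; clear -d4; lia.
  apply: leq_trans (M_lower bq) _; rewrite mulnCA leq_mul2l; apply/orP; right.
  rewrite (_ : 18 = 2 * 9)%N // expnM -expnMn leq_exp2r // mulnS.
  by rewrite -add1n mulnC leq_add2r expn_gt0 b0.
rewrite leq_pmul2l ?expn_gt0 ?b0 // in Mb.
have D0 : (0 < d.+1 ^ 9)%N by rewrite expn_gt0.
rewrite -(ltn_pmul2r D0); apply: leq_trans Mb.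
rewrite expnMn mulnAC -KE mulnC ltn_pmul2l ?expn_gt0 ?b0 //.
by apply: leq_trans Kb _; rewrite -[leqLHS]expn1 leq_pexp2l // b0.
Qed.

Lemma lower_powR (e : R) : 0 < e -> exists q0 : nat, forall q, (q0 <= q)%N ->
  (q%:R : R) `^ (2 - e) < (M q)%:R.
Proof.
(* Since [(8 * b) ^ (6 * d - 20)] is the power [2 - 20 / (3 * d)] of [(8 * b) ^ (3 * d)], [d] must
   satisfy [20 / (3 * d) <= e]. *)
move=> e0; pose d := (Num.bound (20 / (3 * e)) + 4)%N.
have d4 : (4 <= d)%N by rewrite leq_addl.
have d0 : 0 < (3 * d)%:R :> R by rewrite ltr0n; lia.
have de : 20 / (3 * d)%:R <= e.
  rewrite ler_pdivrMr // natrM mulrCA mulrA -ler_pdivrMl ?mulr_gt0 // mulrC.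
  have : 20 / (3 * e) < (Num.bound (20 / (3 * e)))%:R.
    by rewrite archi_boundP // divr_ge0 // mulr_ge0 // ltW.
  by rewrite /d natrD; lra.
have [q0 q0P] := lower_nat d4; exists (maxn q0 1) => q.
rewrite geq_max => /andP[/q0P[b qb Mb] q1].
apply: le_lt_trans (_ : ((8 * b) ^ (6 * d - 20))%:R < _); last by rewrite ltr_nat.
apply: (@le_trans _ _ (q%:R `^ (2 - 20 / (3 * d)%:R))).
  by rewrite ler_powR ?ler1n // lerB.
apply: (@le_trans _ _ (((8 * b) ^ (3 * d))%:R `^ (2 - 20 / (3 * d)%:R))).
  apply: ge0_ler_powR; rewrite ?nnegrE ?ler0n ?ler_nat //.
  rewrite subr_ge0 ler_pdivrMr // -natrM ler_nat; lia.
rewrite natrX -powR_mulrn ?ler0n // -powRrM.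
rewrite (_ : _ * _ = (6 * d - 20)%:R) ?powR_mulrn ?ler0n ?natrX //.
rewrite natrB; last by lia.
by rewrite mulrBr mulrCA divff ?gt_eqF // -natrM !natrM; lra.
Qed.

Lemma exponent_to_two : exists eta : nat -> R, eta @ \oo --> (0 : R) /\
  \forall q \near \oo, (q%:R : R) `^ (2 - eta q) < (M q)%:R.
Proof.
(* The exact defect of the exponent, plus [q%:R^-1] to make the inequality strict. *)
exists (fun q => 2 - ln (M q)%:R / ln q%:R + q%:R^-1).
have [q1 q1P] := lower_powR ltr01; have [q2 q2P] := M_upper ltr01.
have pos q : (maxn q1 2 <= q)%N -> 0 < ln (q%:R : R) /\ 0 < (M q)%:R :> R.
  rewrite geq_max => /andP[qq1 qq2]; split; first by rewrite ln_gt0 // ltr1n.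
  by apply: le_lt_trans (q1P q qq1); rewrite powR_ge0.
split; last first.
  exists (maxn q1 2) => // q /= qq; have [lnq Mq] := pos q qq.
  have q0 : 0 < q%:R :> R by rewrite ltr0n (leq_trans _ qq) // leq_max orbT.
  rewrite /powR gt_eqF // -[ltRHS]lnK ?posrE // ltr_expR.
  have -> : (2 - (2 - ln (M q)%:R / ln q%:R + q%:R^-1)) * ln q%:R =
      ln (M q)%:R - q%:R^-1 * ln q%:R :> R.
    by field; rewrite !gt_eqF.
  by rewrite ltrBlDr ltrDl mulr_gt0 // invr_gt0.
apply/cvgrPdist_lt => e e0; have e20 : 0 < e / 2 by rewrite divr_gt0.
have [q3 q3P] := lower_powR e20.
exists (maxn (maxn (maxn q1 2) (maxn q2 q3)) (Num.bound (2 / e)).+1) => // q /=.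
rewrite 2!geq_max => /andP[/andP[qq /[!geq_max]/andP[qq2 qq3]] qe].
have [lnq Mq] := pos q qq.
have q0 : 0 < q%:R :> R by rewrite ltr0n (leq_trans _ qe).
have qV : 0 < q%:R^-1 :> R by rewrite invr_gt0.
have qVe : q%:R^-1 < e / 2.
  rewrite -[e / 2]invrK invf_div ltf_pV2 ?posrE ?divr_gt0 //.
  apply: lt_le_trans (archi_boundP _) _; first by rewrite divr_ge0 // ltW.
  by rewrite ler_nat ltnW.
have upper : ln (M q)%:R / ln q%:R <= 2 :> R.
  rewrite ler_pdivrMr // -[2]/(2%:R) mulr_natl -lnXn // ler_ln ?posrE ?exprn_gt0 //.
  by have := q2P q qq2; rewrite mul1r.
have lower : 2 - e / 2 < ln (M q)%:R / ln q%:R :> R.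
  have := q3P q qq3; rewrite /powR gt_eqF // -[ltRHS]lnK ?posrE // ltr_expR.
  by rewrite ltr_pdivlMr.
by rewrite sub0r normrN ger0_norm; lra.
Qed.
End Asymptotics.

Theorem proposition4p10 (R : realType) :
  ((exists eta : nat -> R, eta @ \oo --> (0 : R) /\
      \forall q \near \oo,
        (q%:R : R) `^ (2 - eta q) < (max_SHF 3 q [:: 1; 1; 1]%N)%:R) /\
   (fun q : nat => (max_SHF 3 q [:: 1; 1; 1]%N)%:R : R^o)
     =o_\oo (fun q : nat => (q%:R : R) ^+ 2 : R^o)) /\
  ((exists eta : nat -> R, eta @ \oo --> (0 : R) /\
      \forall q \near \oo,
        (q%:R : R) `^ (2 - eta q) < (max_SHF 4 q [:: 1; 1; 1; 1]%N)%:R) /\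
   (\forall q \near \oo,
      (max_SHF 4 q [:: 1; 1; 1; 1] <= max_SHF 4 q [:: 1; 1; 2])%N /\
      (max_SHF 4 q [:: 1; 1; 2] <= max_SHF 4 q [:: 2; 2])%N) /\
   (fun q : nat => (max_SHF 4 q [:: 2; 2]%N)%:R : R^o)
     =o_\oo (fun q : nat => (q%:R : R) ^+ 2 : R^o)).
Proof.
have up3 (eps : R) : 0 < eps -> exists q0, forall q, (q0 <= q)%N ->
    (max_SHF 3 q [:: 1; 1; 1]%N)%:R <= eps * q%:R ^+ 2.
  move=> /SHF_111_upper[q0 q0P]; exists q0 => q /q0P; apply.
  by have [] := @max_SHFP 3 q [:: 1; 1; 1]%N isT isT.
have up4 (eps : R) : 0 < eps -> exists q0, forall q, (q0 <= q)%N ->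
    (max_SHF 4 q [:: 2; 2]%N)%:R <= eps * q%:R ^+ 2.
  move=> /SHF_22_upper[q0 q0P]; exists q0 => q /q0P; apply.
  by have [] := @max_SHFP 4 q [:: 2; 2]%N isT isT.
have le1 q : (max_SHF 4 q [:: 1; 1; 1; 1] <= max_SHF 4 q [:: 1; 1; 2])%N.
  by apply: max_SHF_le => // n A; apply: is_SHF_112_of_1111.
have le2 q : (max_SHF 4 q [:: 1; 1; 2] <= max_SHF 4 q [:: 2; 2])%N.
  by apply: max_SHF_le => // n A; apply: is_SHF_22_of_112.
split; split.
- apply: exponent_to_two => // d b q alph.
  exact: (@max_SHF_ones_lower R d b 3 q isT alph).
- exact: quadratic_littleo.
(* The upper bound for four singletons comes from type {2,2} through the chain of inequalities. *)
- apply: exponent_to_two => [eps /up4[q0 q0P]|d b q alph].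
    exists q0 => q /q0P; apply: le_trans; rewrite ler_nat.
    exact: leq_trans (le1 q) (le2 q).
  exact: (@max_SHF_ones_lower R d b 4 q isT alph).
split; last exact: quadratic_littleo.
by exists 0%N => // q _; split.
Qed.
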